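(* For every integer $n\geq 1$, \[ \sum_{\pi\in T(n)} q^{|\pi/S_3|}=\prod_{1 \leq i \leq j \leq k \leq n}\frac{1-q^{i+j+k-1}}{1-q^{i+j+k-2}}, \] as an identity of rational functions in the indeterminate $q$ (equivalently, of formal power series in $q$).
   Context: A plane partition $\pi$ is an array $(\pi_{i,j})_{i,j\geq 1}$ of nonnegative integers with finite sum $|\pi|=\sum\pi_{i,j}$, weakly decreasing along rows and columns: $\pi_{i,j}\geq \pi_{i+1,j}$ and $\pi_{i,j}\geq\pi_{i,j+1}$. Its 3D Ferrers diagram is the set of unit cubes at locations $(i,j,k)$ with $i,j\geq1$ and $1\leq k\leq \pi_{i,j}$. The plane partition is totally symmetric if its diagram is invariant under the action of the symmetric group $S_3$ permuting the three coordinates, i.e. whenever $(i,j,k)$ is in the diagram, so are all its permutations. For a totally symmetric plane partition $\pi$, $\pi/S_3$ denotes the set of orbits of the cubes of its diagram under this $S_3$-action, and $|\pi/S_3|$ is the number of such orbits. $T(n)$ denotes the set of totally symmetric plane partitions with largest part at most $n$, i.e. whose diagram is contained in $\{1,\dots,n\}^3$ (the empty plane partition included). *)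

(* Defs.v *)
From HB Require Import structures.
From mathcomp Require Import all_boot all_order all_algebra all_fingroup.
Set Implicit Arguments. Unset Strict Implicit. Unset Printing Implicit Defensive.

(* A cube of {1..n}^3, written 0-indexed: coordinates in 'I_n. *)
Definition cube (n : nat) := {ffun 'I_3 -> 'I_n}.

Definition permc (n : nat) (s : 'S_3) (c : cube n) : cube n :=
  [ffun i => c (s i)].

(* A plane partition with largest part at most n and support in the
   n x n corner: entry (i,j) (0-indexed) is a value in {0,..,n}. *)
Definition parray (n : nat) := {ffun 'I_n * 'I_n -> 'I_n.+1}.

Definition is_pp (n : nat) (f : parray n) : bool :=
  [forall i : 'I_n, forall j : 'I_n, forall i' : 'I_n, forall j' : 'I_n,
     ((i <= i') && (j <= j')) ==> (f (i', j') <= f (i, j))].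

(* 3D Ferrers diagram: cube (i,j,k) (1-indexed) with k <= pi_{i,j};
   0-indexed: c 2 < f (c 0, c 1). *)
Definition diagram (n : nat) (f : parray n) : {set cube n} :=
  [set c : cube n | (nat_of_ord (c ord_max) < f (c ord0, c (inord 1)))%N].

Definition totally_symmetric (n : nat) (f : parray n) : bool :=
  [forall s : 'S_3, forall c in diagram f, permc s c \in diagram f].

Definition TSPP (n : nat) : {set parray n} :=
  [set f : parray n | is_pp f && totally_symmetric f].

Definition orbit3 (n : nat) (c : cube n) : {set cube n} :=
  [set permc s c | s : 'S_3].

Definition orbits3 (n : nat) (f : parray n) : {set {set cube n}} :=
  [set orbit3 c | c in diagram f].

Definition RatFun := {fraction {poly rat}}.
Definition qvar : RatFun := tofrac 'X.

(* Main.v *)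
(* A totally symmetric plane partition is determined by its sorted cubes (a, a+k, a+k+m).
   For fixed m the numbers h(k, m) of such cubes drop by 0 or 1 as k grows, hence are encoded
   by a bit vector, and passing from m+1 to m moves some bits by one place and may insert one
   at the bottom.  So the generating function G_n is the sum of all coordinates of
     W_n = (1 + e_1) /\ ... /\ (1 + e_n),  e_m = q^m z (1 + q z) ... (1 + q^(m-1) z),
   in the exterior algebra on z, ..., z^n.

   Both the linear form "sum of the coordinates" and the vector W_n are annihilated by many
   elements of the Clifford algebra.  Comparing the two families, sequences s and t with
     s_1 = t_1,  \sum_k (s_(k+1) - s_k) z^k = \sum_m (t_m + t_(m+1)) e_m,
     phi(e_m) = t_(m+1) - t_m for m < n, where phi(z^k) = s_k + s_(k+1),
   give (t_n + t_(n+1)) G_n = (s_(n+1) + t_(n+1)) G_(n-1), see [total_ratio].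

   Such sequences are constructed by recursion on n.  The tail f_n, i.e. the functional
   measuring the failure of the last condition for m >= n, satisfies a three-term recurrence
   alpha f_n B + beta f_(n+2) B = f_(n+1) A with A and B in the algebra generated by
   (fX)(k) = f(k+1) and (fY)(k) = q^k (f(k) + q f(k+1)).  Defining f_(n+2) by it, one must see
   that f_(n+2) vanishes up to n+2; this follows from further linear relations between f_n and
   f_(n+1) with coefficients in that algebra, a system which the recurrence preserves
   ([closure1] to [closure4]). *)

Require Import Defs.
From HB Require Import structures.
From mathcomp Require Import all_boot all_order all_algebra all_fingroup.
From mathcomp Require Import ring zify.
From Stdlib Require Import FunctionalExtensionality.
Set Implicit Arguments. Unset Strict Implicit. Unset Printing Implicit Defensive.
Import GRing.Theory.

(** * Chains of bit vectors *)

Section Chains.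

Fixpoint allbits n : seq (seq bool) :=
  if n is n'.+1 then map (cons false) (allbits n') ++ map (cons true) (allbits n')
  else [:: [::]].

Lemma mem_allbits n l : (l \in allbits n) = (size l == n).
Proof.
elim: n l => [|n IH] l /=; first by rewrite inE size_eq0.
rewrite mem_cat; apply/orP/eqP => [[] /mapP[l' + ->]|].
- by rewrite IH => /eqP /= ->.
- by rewrite IH => /eqP /= ->.
case: l => [|b l] // [sl].
by case: b; [right|left]; apply: map_f; rewrite IH sl.
Qed.

Lemma allbits_uniq n : uniq (allbits n).
Proof.
elim: n => //= n IH; rewrite cat_uniq !map_inj_uniq ?IH; try by move=> ? ? [].
by rewrite andbT; apply/hasPn => _ /mapP[l _ ->]; apply/mapP => -[].
Qed.

Fixpoint seqs (T : eqType) m (A : seq T) : seq (seq T) :=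
  if m is m'.+1 then [seq x :: c | x <- A, c <- seqs m' A] else [:: [::]].

Lemma mem_seqs (T : eqType) m (A : seq T) c :
  (c \in seqs m A) = (size c == m) && all (mem A) c.
Proof.
elim: m c => [|m IH] c /=; first by rewrite inE; case: c.
apply/allpairsP/andP => [[[x c'] /= [xA c'A ->]]|].
  by move: c'A; rewrite IH /= => /andP[/eqP -> ->]; rewrite xA.
case: c => [|x c] [] //= /eqP [sc] /andP[xA cA].
by exists (x, c); rewrite IH sc eqxx.
Qed.

Lemma seqs_uniq (T : eqType) m (A : seq T) : uniq A -> uniq (seqs m A).
Proof.
move=> uA; elim: m => //= m IH; apply: allpairs_uniq => //.
by move=> [x c] [x' c'] _ _ /= [-> ->].
Qed.

(* [compat c l' l]: the list [l] arises from [l'] by moving some of the occupied sites one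
   step up, together with a new particle at the first site if [c]. *)
Fixpoint compat c (l' l : seq bool) : bool :=
  match l', l with
  | [::], [::] => ~~ c
  | b' :: l', false :: l => ~~ c && compat b' l' l
  | b' :: l', true :: l => if c then compat b' l' l else b' && compat false l' l
  | _, _ => false
  end.

Definition rstep l l' := compat false l' l || compat true l' l.

(** [count id (drop k l)] is the number of particles beyond the first k sites. Particles that stay
    or move one step up change these numbers by interlacing inequalities, and conversely the
    inequalities determine the moves site by site. *)
Lemma compatP (c : bool) l' l : reflect
  [/\ size l' = size l, count id l = (c + count id l')%N &
      forall k, (count id (drop k l') <= count id (drop k l))%N /\
                (count id (drop k.+1 l) <= count id (drop k l'))%N]
  (compat c l' l).
Proof.
elim: l' l c => [|b' l' IH] [|b l] c /=; try by apply: ReflectF => -[].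
  by case: c; constructor; [case | split].
apply: (iffP idP) => [|[sl ce h]].
  (* [c2] is the particle passed to the next site: [b + c2 = b' + c] is the balance at the current
     site, and [c2 <= b'] says that only a particle already there can leave it. *)
  have E (c2 : bool) : compat c2 l' l -> (b + c2 = b' + c)%N -> (c2 <= b')%N ->
      [/\ (size l').+1 = (size l).+1,
      (b + count id l)%N = (c + (b' + count id l'))%N
    & forall k, (count id (drop k (b' :: l')) <= count id (drop k (b :: l)))%N /\
        (count id (drop k.+1 (b :: l)) <= count id (drop k (b' :: l')))%N].
    move=> /IH[-> ce h] e e'; split => //; first by lia.
    case=> [|k]; last exact: h.
    by have := h 0; rewrite /= !drop0; lia.
  case: b E => [|] E; last by case: c E => //= E /E; apply; lia.
  case: c E => [|] E; first by move/E; apply; lia.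
  by case/andP => b'1 /E; apply; rewrite b'1.
have [_ h3] := h 0; rewrite /= !drop0 in h3.
have [h1 _] := h 1; rewrite /= !drop0 in h1.
have H (c2 : bool) : count id l = (c2 + count id l')%N -> compat c2 l' l.
  by move=> e; apply/IH; split => // [|k]; [case: sl | exact: (h k.+1)].
move: ce; case: b {h} => /= ce; last by rewrite H; lia.
case: c ce => ce; first by apply: H; lia.
by rewrite H; lia.
Qed.

(** The inequalities at [k = 0] force the particle counts to differ by 0 or 1, which decides the
    value of [c]. *)
Lemma rstepP l l' : reflect
  (size l' = size l /\
      forall k, (count id (drop k l') <= count id (drop k l))%N /\
                (count id (drop k.+1 l) <= count id (drop k l'))%N)
  (rstep l l').
Proof.
apply: (iffP orP) => [[/compatP[? _ ?]|/compatP[? _ ?]] //|[s h]].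
have [h1 _] := h 0; have [_ h2] := h 0.
rewrite !drop0 in h1 h2.
have [e|ne] := eqVneq (count id l) (count id l').
  by left; apply/compatP.
right; apply/compatP; split => //.
case: l l' s h1 h2 ne {h} => [|b l] [|b' l'] //= _ h1 h2 ne; rewrite drop0 in h2.
by case: b h1 h2 ne; case: b'; lia.
Qed.

Definition valid_chain (L : seq (seq bool)) := sorted rstep L && ~~ has id (last [::] L).

End Chains.

(** * Plane partitions as chains *)

Section Counting.

(** A down-closed [P] is an initial segment and its count is the threshold; this converts between
    diagrams and heights. *)
Lemma count_down (P : pred nat) N a :
  (forall i, P i.+1 -> P i) -> (forall i, P i -> i < N) -> (a < count P (iota 0 N)) = P a.
Proof.
elim: N P a => [|N IH] P a PS PN.
  by apply/esym/negP => /PN.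
rewrite /= (_ : count P (iota 1 N) = count (P \o S) (iota 0 N)); last first.
  by rewrite (iotaDl 1 0) count_map.
have IHS i : (i < count (P \o S) (iota 0 N)) = P i.+1.
  by apply: IH => j /=; [apply: PS | move/PN].
have [P0|P0] := boolP (P 0); first by case: a => [|a] //; rewrite add1n ltnS IHS.
have Pf i : P i = false by elim: i => [|i IHi]; [exact: negbTE | apply/negP => /PS; rewrite IHi].
by have := IHS 0; rewrite !Pf add0n lt0n => /negbFE /eqP ->.
Qed.

Lemma ltn_leq x y : (forall a, a < x -> a < y) -> x <= y.
Proof. by move=> h; rewrite leqNgt; apply/negP => /h; rewrite ltnn. Qed.

Lemma count_drops (h : nat -> nat) k j :
  (forall i, h i.+1 <= h i <= (h i.+1).+1) ->
  count id [seq h i.+1 < h i | i <- iota k j] + h (k + j) = h k.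
Proof.
move=> hh; elim: j k => [|j IH] k; first by rewrite addn0.
by have := IH k.+1; have := hh k; rewrite /= addnS addSn; case: ltnP; lia.
Qed.

Lemma count_drop_nth (l : seq bool) k :
  count id (drop k l) = nth false l k + count id (drop k.+1 l).
Proof.
have [kl|lk] := ltnP k (size l); first by rewrite (drop_nth false kl).
by rewrite nth_default // !drop_oversize // ltnW.
Qed.

Definition mn3 a b c := minn a (minn b c).
Definition mx3 a b c := maxn a (maxn b c).
Definition md3 a b c := a + b + c - mn3 a b c - mx3 a b c.

Lemma sort3 a b c : sort leq [:: a; b; c] = [:: mn3 a b c; md3 a b c; mx3 a b c].
Proof.
rewrite /sort /= /md3 /mn3 /mx3.
by do 3?[case: leqP => /= ?]; congr [:: _; _; _]; lia.
Qed.

Lemma mid3 a b c : mn3 a b c <= md3 a b c <= mx3 a b c.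
Proof. by rewrite /md3 /mn3 /mx3; lia. Qed.

End Counting.

(** * Heights of sorted cubes and the bijection with chains *)

Section Plane.
Variable n' : nat.
Local Notation n := n'.+1.
Implicit Types (f g : parray n) (x y : cube n).

(** The bounds are part of the predicate because [inord] sends out-of-range values to a default
    index. *)
Definition in_diagram f a b c := [&& a < n, b < n & c < f (inord a, inord b)].

Definition coords x := [:: x ord0 : nat; x (inord 1) : nat; x ord_max : nat].

Definition cube3 a b c : cube n := [ffun i : 'I_3 => inord (nth 0 [:: a; b; c] i)].

Lemma coords_cube3 a b c : a < n -> b < n -> c < n -> coords (cube3 a b c) = [:: a; b; c].
Proof.
by move=> an bn cn; rewrite /coords /cube3 !ffunE /= !inordK.
Qed.

Lemma coordsE x : coords x = [tuple (x i : nat) | i < 3].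
Proof.
apply: (@eq_from_nth _ 0) => [|i i3]; first by rewrite size_tuple.
rewrite -[i]/(nat_of_ord (Ordinal (i3 : i < 3))) -tnth_nth tnth_mktuple /coords.
by case: i i3 => [|[|[|i]]] i3 //=; congr (nat_of_ord (x _)); apply: val_inj; rewrite /= ?inordK.
Qed.

Lemma perm_coordsP x y : reflect (exists s : 'S_3, y = permc s x) (perm_eq (coords y) (coords x)).
Proof.
rewrite !coordsE; apply: (iffP tuple_permP) => -[s e]; exists s.
  apply/ffunP => i; apply: val_inj; rewrite ffunE /=.
  by have /(congr1 (fun t => tnth t i)) := val_inj e; rewrite !tnth_mktuple.
by congr tval; apply: eq_from_tnth => i; rewrite e !tnth_mktuple ffunE.
Qed.

Lemma mem_diagram f x :
  (x \in diagram f) = in_diagram f (x ord0) (x (inord 1)) (x ord_max).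
Proof. by rewrite inE /in_diagram !ltn_ord !inord_val. Qed.

Lemma in_diagram_bound f a b c : in_diagram f a b c -> [&& a < n, b < n & c < n].
Proof.
case/and3P => -> -> /= /leq_trans; apply; by rewrite -ltnS ltn_ord.
Qed.

Lemma in_diagram_cube3 f a b c : a < n -> b < n -> c < n ->
  in_diagram f a b c = (cube3 a b c \in diagram f).
Proof.
move=> an bn cn; rewrite mem_diagram; have := coords_cube3 an bn cn.
by case=> -> -> ->.
Qed.

Lemma in_diagram_perm f a b c a1 b1 c1 : f \in TSPP n ->
  perm_eq [:: a1; b1; c1] [:: a; b; c] -> in_diagram f a b c -> in_diagram f a1 b1 c1.
Proof.
rewrite inE => /andP[_ /forallP ts] p fD.
have /and3P[an bn cn] := in_diagram_bound fD.
have all_n : all (gtn n) [:: a1; b1; c1] by rewrite (perm_all _ p) /= an bn cn.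
have /and4P[a1n b1n c1n _] := all_n.
move: p; rewrite -(coords_cube3 an bn cn) -(coords_cube3 a1n b1n c1n) => /perm_coordsP[s e].
rewrite in_diagram_cube3 // e; have /forall_inP := ts s; apply.
by rewrite -in_diagram_cube3.
Qed.

Lemma in_diagram_le f a b c a1 b1 c1 : f \in TSPP n ->
  a1 <= a -> b1 <= b -> c1 <= c -> in_diagram f a b c -> in_diagram f a1 b1 c1.
Proof.
rewrite inE => /andP[/forallP pp _] aa bb cc /and3P[an bn cn].
have a1n := leq_ltn_trans aa an; have b1n := leq_ltn_trans bb bn.
rewrite /in_diagram a1n b1n /=.
have /forallP/(_ (inord b1))/forallP/(_ (inord a))/forallP/(_ (inord b)) := pp (inord a1).
by rewrite !inordK // aa bb /=; apply: leq_trans; apply: leq_ltn_trans cn.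
Qed.

Lemma in_diagram_inj f g : (forall a b c, in_diagram f a b c = in_diagram g a b c) -> f = g.
Proof.
move=> fg; apply/ffunP => -[i j]; apply: val_inj.
have E c : (c < f (i, j)) = (c < g (i, j)).
  by have := fg i j c; rewrite /in_diagram !ltn_ord !inord_val.
by apply/eqP; rewrite eqn_leq; apply/andP; split; apply: ltn_leq => c; rewrite E.
Qed.

(** Used to build a preimage in [chain_surj]. The entry at (a, b) counts the c with [E a b c], an
    initial segment by monotonicity. *)
Lemma TSPP_of (E : nat -> nat -> nat -> bool) :
    (forall a b c, E a b c -> [&& a < n, b < n & c < n]) ->
    (forall a b c a1 b1 c1, perm_eq [:: a1; b1; c1] [:: a; b; c] -> E a b c -> E a1 b1 c1) ->
    (forall a b c a1 b1 c1, a1 <= a -> b1 <= b -> c1 <= c -> E a b c -> E a1 b1 c1) ->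
  exists2 f, f \in TSPP n & forall a b c, in_diagram f a b c = E a b c.
Proof.
move=> Eb Ep El.
pose f : parray n := [ffun p : 'I_n * 'I_n => inord (count (E p.1 p.2) (iota 0 n))].
have fE a b c : in_diagram f a b c = E a b c.
  have fab : a < n -> b < n -> (c < f (inord a, inord b)) = E a b c.
    move=> an bn; have cE : count (E a b) (iota 0 n) < n.+1.
      by rewrite ltnS (leq_trans (count_size _ _)) ?size_iota.
    rewrite ffunE inordK !inordK // count_down // => i; first by apply: El.
    by case/Eb/and3P.
  apply/and3P/idP => [[an bn]|e]; first by rewrite fab.
  by have /and3P[an bn cn] := Eb _ _ _ e; rewrite fab.
exists f => //; rewrite inE; apply/andP; split.
  apply/forallP => i; apply/forallP => j; apply/forallP => i1; apply/forallP => j1.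
  apply/implyP => /andP[ii jj]; apply: ltn_leq => c.
  have E1 (k l : 'I_n) : (c < f (k, l)) = E k l c.
    by rewrite -fE /in_diagram !ltn_ord !inord_val.
  by rewrite !E1; apply: El.
apply/forallP => s; apply/forall_inP => x; rewrite !mem_diagram !fE.
apply: Ep; rewrite -/(coords _) -/(coords x); apply/perm_coordsP; by exists s.
Qed.

(** The number h(k, m) of the overview. *)
Definition height f k m := count (fun a => in_diagram f a (a + k) (a + k + m)) (iota 0 n).

Lemma heightP f k m a : f \in TSPP n -> (a < height f k m) = in_diagram f a (a + k) (a + k + m).
Proof.
move=> fT; rewrite /height count_down // => i; last by case/and3P.
by apply: in_diagram_le => //; lia.
Qed.

Lemma height_large f k m : f \in TSPP n -> n <= k + m -> height f k m = 0.
Proof.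
move=> fT nkm; apply/eqP; rewrite -leqn0 leqNgt heightP //.
by apply/negP => /in_diagram_bound; lia.
Qed.

(** The cube (a+1, a+1+k, a+1+k+m) dominates (a, a+k+1, a+k+1+m), so a drop is at most one. *)
Lemma height_slope f k m : f \in TSPP n -> height f k.+1 m <= height f k m <= (height f k.+1 m).+1.
Proof.
move=> fT; apply/andP; split; apply: ltn_leq => a.
  by rewrite !heightP //; apply: in_diagram_le => //; lia.
case: a => // a; rewrite ltnS !heightP //; by apply: in_diagram_le => //; lia.
Qed.

(** The cube (a, a+k+1, a+k+1+m) dominates (a, a+k, a+k+m+1). These are the inequalities of [rstepP]
    for consecutive rows. *)
Lemma height_step f k m : f \in TSPP n ->
  height f k m.+1 <= height f k m /\ height f k.+1 m <= height f k m.+1.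
Proof.
by move=> fT; split; apply: ltn_leq => a; rewrite !heightP //; apply: in_diagram_le => //; lia.
Qed.

Definition bitrow f m := [seq height f k.+1 m < height f k m | k <- iota 0 n].

Definition chain f := [seq bitrow f m | m <- iota 0 n.+1].

Lemma count_bitrow f k m : f \in TSPP n -> count id (drop k (bitrow f m)) = height f k m.
Proof.
move=> fT; have [kn|nk] := leqP k n; last first.
  by rewrite drop_oversize ?size_map ?size_iota ?(ltnW nk) // height_large //; lia.
have := count_drops k (n - k) (fun i => height_slope i m fT).
rewrite subnKC // (@height_large f n) ?leq_addr // addn0 => <-.
by rewrite /bitrow -map_drop drop_iota.
Qed.

Lemma size_bitrow f m : size (bitrow f m) = n.
Proof. by rewrite size_map size_iota. Qed.

Lemma nth_chain f m : m <= n -> nth [::] (chain f) m = bitrow f m.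
Proof. by move=> mn; rewrite (nth_map 0) ?size_iota // nth_iota. Qed.

Lemma size_chain f : size (chain f) = n.+1.
Proof. by rewrite size_map size_iota. Qed.

Lemma chain_seqs f : chain f \in seqs n.+1 (allbits n).
Proof.
rewrite mem_seqs size_chain eqxx andTb; apply/allP => _ /mapP[m _ ->].
by rewrite inE mem_allbits size_bitrow.
Qed.

Lemma chain_valid f : f \in TSPP n -> valid_chain (chain f).
Proof.
move=> fT; apply/andP; split.
  apply/(sortedP [::]) => i; rewrite size_chain ltnS => i_n.
  rewrite !nth_chain ?(ltnW i_n) //; apply/rstepP; rewrite !size_bitrow; split=> // k.
  by rewrite !count_bitrow //; apply: height_step.
rewrite (last_nth [::]) size_chain -[nth _ _ _]/(nth [::] (chain f) n) nth_chain //
  has_count -(drop0 (bitrow f n)) count_bitrow //.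
by rewrite height_large.
Qed.

Lemma in_diagram_sort f a b c : f \in TSPP n ->
  in_diagram f a b c = (mn3 a b c < height f (md3 a b c - mn3 a b c) (mx3 a b c - md3 a b c)).
Proof.
move=> fT; have /andP[m1 m2] := mid3 a b c; rewrite heightP // (subnKC m1) (subnKC m2).
have p : perm_eq [:: mn3 a b c; md3 a b c; mx3 a b c] [:: a; b; c].
  by rewrite -sort3 perm_sort.
by apply/idP/idP; apply: in_diagram_perm; rewrite // perm_sym.
Qed.

Lemma chain_inj : {in TSPP n &, injective chain}.
Proof.
move=> f g fT gT fg; apply: in_diagram_inj => a b c.
have E k m : height f k m = height g k m.
  have [mn|nm] := leqP m n; last by rewrite !height_large //; lia.
  by rewrite -!count_bitrow // -!nth_chain // fg.
by rewrite !in_diagram_sort // E.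
Qed.

(** The heights are recovered as particle counts, and membership of a triple is decided on its
    sorted form. *)
Lemma chain_surj L : L \in seqs n.+1 (allbits n) -> valid_chain L ->
  exists2 f, f \in TSPP n & chain f = L.
Proof.
rewrite mem_seqs => /andP[/eqP sL /allP LA] /andP[/(sortedP [::]) sortL lastL].
pose h k m := count id (drop k (nth [::] L m)).
have size_nth m : m <= n -> size (nth [::] L m) = n.
  by move=> mn; apply/eqP; rewrite -mem_allbits; apply: LA; rewrite mem_nth ?sL.
have h_large k m : n <= m -> h k m = 0.
  rewrite leq_eqVlt => /orP[/eqP <-|nm]; last by rewrite /h nth_default ?sL.
  move: lastL; rewrite (last_nth [::]) sL -[nth _ _ _]/(nth [::] L n) -[nth _ L n](cat_take_drop k)
    has_cat.
  by case/norP => _; rewrite has_count -eqn0Ngt => /eqP.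
have h_step k m : h k m.+1 <= h k m /\ h k.+1 m <= h k m.+1.
  have [nm|mn] := leqP n m; first by rewrite !h_large // ltnW.
  have /rstepP[_ /(_ k)] // : rstep (nth [::] L m) (nth [::] L m.+1).
  by apply: sortL; rewrite sL ltnS.
have h_slope k m : h k.+1 m <= h k m <= (h k.+1 m).+1.
  by rewrite /h (count_drop_nth _ k); case: (nth false _ _) => /=;
    rewrite ?add0n ?add1n ?leqnn ?leqnSn.
(* [hA], [hB] and [hC] control the lowering by i of the smallest, the middle and the largest
   coordinate of a sorted triple. *)
have hA k m i : h k m <= h (k + i) m + i.
  elim: i => [|i IH]; first by rewrite !addn0.
  by have := h_slope (k + i) m; rewrite !addnS; lia.
have hB k m i : h (k + i) m <= h k (m + i).
  elim: i k m => [|i IH] k m; first by rewrite !addn0.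
  by rewrite addnS; case: (h_step (k + i) m) => _ /leq_trans; apply; rewrite addnS -addSn.
have hC k m i : h k (m + i) <= h k m.
  elim: i => [|i IH]; first by rewrite addn0.
  by rewrite addnS; case: (h_step k (m + i)) => /leq_trans + _; apply.
(* With j = n - (m + k): h k m <= h 0 (m + k) <= h j (m + k) + j <= h 0 n + j = j. *)
have h_bound k m a : a < h k m -> a + k + m < n.
  move=> ah; rewrite ltnNge; apply/negP => nakm.
  have [mn|nm] := ltnP m n; last by rewrite h_large in ah.
  have hkm : h k m <= h 0 (m + k) by have := hB 0 m k.
  have : h 0 (m + k) <= h (n - (m + k)) (m + k) + (n - (m + k)) by apply: (hA 0).
  have : h (0 + (n - (m + k))) (m + k) <= h 0 (m + k + (n - (m + k))) by apply: hB.
  by rewrite add0n (h_large 0); lia.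
pose E a b c := mn3 a b c < h (md3 a b c - mn3 a b c) (mx3 a b c - md3 a b c).
have [||a b c a1 b1 c1 aa bb cc|f fT fE] := @TSPP_of E.
- move=> a b c /h_bound; rewrite /mn3 /md3 /mx3; lia.
- move=> a b c a1 b1 c1 /(perm_sortP leq_total leq_trans anti_leq).
  by rewrite !sort3 /E => -[-> -> ->].
- rewrite /E.
  have m1 : mn3 a1 b1 c1 <= mn3 a b c by rewrite /mn3; lia.
  have m2 : md3 a1 b1 c1 <= md3 a b c by rewrite /md3 /mn3 /mx3; lia.
  have m3 : mx3 a1 b1 c1 <= mx3 a b c by rewrite /mx3; lia.
  have := mid3 a1 b1 c1; have := mid3 a b c.
  move: m1 m2 m3.
  move: (mn3 a b c) (md3 a b c) (mx3 a b c) (mn3 a1 b1 c1) (md3 a1 b1 c1) (mx3 a1 b1 c1).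
  move=> x y z x1 y1 z1 xx yy zz /andP[xy yz] /andP[xy1 yz1] hx.
  have := hA (y - x) (z - y) (x - x1).
  have := hB (y1 - x1) (z - y) (y - y1).
  have := hC (y1 - x1) (z1 - y1) (z - z1).
  rewrite (_ : y - x + (x - x1) = y1 - x1 + (y - y1)); last lia.
  rewrite (_ : z1 - y1 + (z - z1) = z - y + (y - y1)); last lia.
  lia.
exists f => //; apply: (@eq_from_nth _ [::]); rewrite size_chain ?sL // => m mn.
rewrite nth_chain //.
have hE k : height f k m = h k m.
  have A a : (a < height f k m) = (a < h k m).
    rewrite heightP // fE /E.
    have : [:: mn3 a (a + k) (a + k + m); md3 a (a + k) (a + k + m); mx3 a (a + k) (a + k + m)]
        = [:: a; a + k; a + k + m].
      by rewrite -sort3 sorted_sort //= ?leq_addr //; apply: leq_trans.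
    by case=> -> -> ->; rewrite !addKn.
  by apply/eqP; rewrite eqn_leq; apply/andP; split; apply: ltn_leq => a; rewrite A.
apply: (@eq_from_nth _ false); rewrite size_bitrow ?size_nth // => k kn.
rewrite (nth_map 0) ?size_iota // nth_iota // !hE add0n /h (count_drop_nth _ k).
by case: (nth false _ _); rewrite ?add1n ?ltnS ?add0n ?ltnn ?leqnn.
Qed.

End Plane.

(** * Orbits of cubes *)

Section Orbits.
Variable n' : nat.
Local Notation n := n'.+1.
Implicit Types (f g : parray n) (x y : cube n).

Lemma orbit3P x y : reflect (exists s : 'S_3, y = permc s x) (y \in orbit3 x).
Proof. by apply: (iffP imsetP) => [[s _ ->]|[s ->]]; exists s. Qed.

Lemma orbit3_eq x y : perm_eq (coords y) (coords x) -> orbit3 y = orbit3 x.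
Proof.
move=> p; apply/setP => z; apply/orbit3P/orbit3P => /perm_coordsP zy; apply/perm_coordsP.
  exact: perm_trans zy p.
by apply: perm_trans zy _; rewrite perm_sym.
Qed.

Lemma mem_orbit3 x : x \in orbit3 x.
Proof. by apply/orbit3P/perm_coordsP. Qed.

Definition dcube (t : 'I_n.+1 * 'I_n * 'I_n) : cube n :=
  let: (m, k, a) := t in cube3 n' a (a + k) (a + k + m).

(** Each orbit contains exactly one sorted cube (a, a+k, a+k+m), and [height f k m] counts those
    with given k and m. *)
Lemma card_orbits3 f : f \in TSPP n ->
  #|orbits3 f| = \sum_(m < n.+1) \sum_(k < n) height f k m.
Proof.
move=> fT.
pose T := [set t : 'I_n.+1 * 'I_n * 'I_n |
  in_diagram f t.2 (t.2 + t.1.2) (t.2 + t.1.2 + t.1.1)].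
have coordsT t : t \in T -> coords (dcube t) = [:: t.2 : nat; t.2 + t.1.2; t.2 + t.1.2 + t.1.1].
  case: t => [[m k] a]; rewrite inE /= => /in_diagram_bound/and3P[? ? ?].
  by rewrite coords_cube3.
have -> : orbits3 f = [set orbit3 (dcube t) | t in T].
  apply/setP => O; apply/imsetP/imsetP => [[x xf ->]|[t tT ->]]; last first.
    exists (dcube t) => //; case: t tT => [[m k] a]; rewrite inE /= => tD.
    by have /and3P[? ? ?] := in_diagram_bound tD; rewrite -in_diagram_cube3.
  have /andP[m1 m2] := mid3 (x ord0) (x (inord 1)) (x ord_max).
  have p : perm_eq [:: mn3 (x ord0) (x (inord 1)) (x ord_max);
    md3 (x ord0) (x (inord 1)) (x ord_max); mx3 (x ord0) (x (inord 1)) (x ord_max)] (coords x).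
    by rewrite -sort3 perm_sort.
  move: xf; rewrite mem_diagram => /(in_diagram_perm fT p).
  move: p m1 m2; move: (mn3 _ _ _) (md3 _ _ _) (mx3 _ _ _) => a b c p ab bc D.
  have /and3P[an bn cn] := in_diagram_bound D.
  have cn1 : c - b < n.+1 by lia.
  have bn1 : b - a < n by lia.
  pose t := (Ordinal cn1, Ordinal bn1, Ordinal an).
  have tT : t \in T by rewrite inE /= !subnKC.
  exists t => //; apply/esym/orbit3_eq; rewrite coordsT //= !subnKC //.
rewrite card_in_imset => [|t u tT uT tu]; last first.
  have : dcube u \in orbit3 (dcube t) by rewrite tu mem_orbit3.
  move/orbit3P/perm_coordsP; rewrite !coordsT // => /(perm_sortP leq_total leq_trans anti_leq).
  rewrite !sort3; case: t u {tT uT tu} => [[m k] a] [[m1 k1] a1] /= [].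
  rewrite /md3 /mn3 /mx3 => e1 e2 e3.
  congr (_, _, _); apply: val_inj => /=; lia.
transitivity (\sum_(m < n.+1) \sum_(k < n) \sum_(a < n) (in_diagram f a (a + k) (a + k + m) : nat)).
  rewrite -sum1_card big_mkcond !pair_bigA /=.
  by apply: eq_bigr => t _; rewrite inE; case: in_diagram.
apply: eq_bigr => m _; apply: eq_bigr => k _.
rewrite /height -sum1_count -[iota 0 n]/(index_iota 0 n) big_mkord [RHS]big_mkcond.
by apply: eq_bigr => a _; case: in_diagram.
Qed.

End Orbits.

Local Open Scope ring_scope.

(** * The recurrence and the ladder relations *)

Section SkewOperators.
Variables (F : fieldType) (q z : F).

(** This is q^k z, defined by recursion so that simplification reduces all shifts to the single atom
    [qshift k] and [ring] can prove operator identities. The base z is 1 for true exponents and q^-8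
    for padded ones. *)
Fixpoint qshift k : F := if k is k'.+1 then q * qshift k' else z.

Definition opY (u : nat -> F) k := qshift k * (u k + q * u k.+1).

Fixpoint opX (cs : seq F) (u : nat -> F) k :=
  if cs is c :: cs' then c * u k + opX cs' u k.+1 else 0.

(* Operators act on the right: [css] lists, for b = 0, 1, ..., the coefficients of
   X^0 Y^b, X^1 Y^b, ..., and u X^a Y^b means that X^a is applied first. *)
Fixpoint act (css : seq (seq F)) (u : nat -> F) k :=
  if css is cs :: css' then opX cs u k + opY (act css' u) k else 0.

(* XY *)
Definition opB (u : nat -> F) := act [:: [::]; [:: 0; 1]] u.

(* q^2 (Y + Y^2 - X Y^2 - X^2 Y) + X - X^2 *)
Definition opA (u : nat -> F) :=
  act [:: [:: 0; 1; -1]; [:: q^+2; 0; - q^+2]; [:: q^+2; - q^+2]] u.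

(* The ladder relations, found by interpolation; N stands for q^n. *)
Definition la1 (N : F) := [:: [:: - q^+3*N^+2; q*N^+2 - q^+2*N + q^+2*N^+3 + q^+3*N^+2;
      N + q^+2*N - q^+2*N^+3; - N - q*N^+2];
      [:: q^+3 - q^+3*N^+2 + q^+4*N^+3; - q^+2 - q^+2*N + q^+2*N^+2 - q^+3 + q^+3*N^+2 -
      q^+4*N + q^+4*N^+2; q^+2 + q^+2*N - q^+2*N^+2 + q^+3*N + q^+4*N - q^+4*N^+3; -
      q^+3*N - q^+4*N^+2];
      [:: q^+3 - q^+4*N + q^+4*N^+3; - q^+3 - q^+4 + q^+4*N + q^+4*N^+2 - q^+4*N^+3 -
      q^+5*N; q^+4 - q^+4*N^+2 + q^+5*N];
      [:: - q^+4*N; q^+4*N]].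
Definition lb1 (N : F) := [:: [:: - q^+4*N^+2; q^+4*N^+2 - q^+5*N^+3; q^+5*N^+3];
      [:: q^+3*N - q^+4*N^+2 - q^+7*N^+3; - q^+2*N - q^+3*N + q^+4*N^+2; q^+2*N +
      q^+7*N^+3];
      [:: q^+3*N + q^+6*N^+2 - q^+7*N^+3; - q^+3*N - q^+4*N - q^+6*N^+2 + q^+7*N^+3;
      q^+4*N];
      [:: q^+6*N^+2; - q^+6*N^+2]].
Definition la2 (N : F) := [:: [:: - q*N; - 1 + q*N - q*N^+3; 1 - N^+2 + q*N^+3; N^+2];
      [:: - q*N - q^+2 + q^+2*N^+2 - q^+3*N; q*N - q*N^+2 + q^+2*N - q^+2*N^+3 + q^+3*N
      - q^+3*N^+2 - q^+3*N^+3; q*N^+2 + q^+2 - q^+2*N - q^+2*N^+2 + q^+2*N^+3 +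
      q^+3*N^+3; q^+3*N^+2];
      [:: - q^+2 + q^+2*N^+2 + q^+4*N^+2; q^+2 - q^+2*N^+2 - q^+3*N^+2 + q^+4*N -
      q^+4*N^+2 - q^+4*N^+3; q^+3*N^+2 - q^+4*N + q^+4*N^+3];
      [:: q^+3*N + q^+4*N^+2; - q^+3*N - q^+4*N^+2]].
Definition lb2 (N : F) := [:: [:: q^+3*N^+2; - N - q^+3*N^+2 + q^+4*N^+3; N - q*N^+2 -
      q^+4*N^+3; q*N^+2];
      [:: - q^+2*N + q^+3*N^+2; - q^+4*N^+2 + q^+5*N^+3 + q^+6*N^+3; q^+2*N - q^+3*N^+2
      - q^+5*N^+3 - q^+6*N^+3; q^+4*N^+2];
      [:: - q^+2*N; q^+2*N + q^+7*N^+3; - q^+7*N^+3]].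
Definition lp0 (N : F) := [:: [:: q^+2*N; q - q^+2*N + q^+2*N^+2; - q + q*N - q^+2*N^+2;
      - q*N];
      [:: - q^+2 + q^+2*N - q^+3*N^+2; q*N + q^+2 - q^+2*N - q^+3*N + q^+3*N^+2 +
      q^+4*N; 1 - q*N + q*N^+2 + q^+3*N; - 1 + N - q*N^+2 - q^+4*N; - N];
      [:: - q^+2 + q^+3*N - q^+3*N^+2; - q^+3*N - q^+5 + q^+5*N - q^+6*N^+2; q^+2 -
      q^+3*N + q^+3*N^+2 + q^+4*N + q^+5 - q^+5*N + q^+6*N^+2; q^+3*N; - q^+4*N];
      [:: q^+3*N; - q^+3*N - q^+6 + q^+7*N - q^+7*N^+2; - q^+7*N; q^+6 + q^+7*N^+2];
      [:: 0; q^+8*N; - q^+8*N]].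
Definition lp1 (N : F) := [:: [:: 0; 0; - q*N; - 1 + q*N - q*N^+2; 1 - N + q*N^+2; N];
      [:: - q^+7*N; - q^+6 + q^+7*N - q^+7*N^+2; q^+3 - q^+3*N + q^+4*N^+2 + q^+6 -
      q^+6*N + q^+7*N^+2; - q^+3 + q^+3*N + q^+4*N - q^+4*N^+2 - q^+5*N + q^+6*N; -
      q^+4*N; q^+5*N];
      [:: q^+7 - q^+7*N + q^+8*N^+2; - q^+6*N - q^+7 + q^+7*N + q^+8*N - q^+8*N^+2; q^+8
      - q^+8*N - q^+9*N + q^+9*N^+2; q^+6*N + q^+9*N; - q^+8 - q^+9*N^+2];
      [:: q^+7 - q^+8*N + q^+8*N^+2; q^+8*N; - q^+7 - q^+8*N^+2 - q^+11*N; q^+11*N];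
      [:: - q^+8*N; q^+8*N]].

Definition kp1 (N : F) := (1 - q*N^+3) * (1 + q*N + q^+2*N^+2).
Definition kp2 (N : F) := q * N^+2 * (1 - q^+8*N^+3).
Definition kp0 (N : F) := N^+2 * (1 - q^+3*N^+2).

(** Its vanishing is the three-term recurrence for f, g, h = f_n, f_(n+1), f_(n+2), with alpha = kp1
    / kp0 and beta = - kp2 / kp0. *)
Definition resT N f g h k :=
  kp2 N * opB h k - kp1 N * opB f k + kp0 N * opA g k.
Definition rel1 N f g k := act (la1 N) f k + act (lb1 N) g k.
Definition rel2 N f g k := act (la2 N) f k + act (lb2 N) g k.
Definition rel3 N f k := act (lp0 N) f k.
Definition rel4 N f k := act (lp1 N) f k.

(* In [closure1] to [closure4] the relations for the next value of n are written as right
   combinations of the present ones; the coefficients come from computer algebra. *)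
Lemma closure1 N f g h k :
  N * (1 + q*N) * (1 + q^+2*N + q^+4*N^+2) * (1 - q^+8*N^+3) * opB (rel1 (q * N) g h) k =
  act [:: [:: - q^+4*N^+2 + q^+5*N^+2 + q^+6*N^+3 + q^+7*N^+3 + 2*q^+7*N^+4 - q^+8*N^+4 -
        q^+9*N^+5 - q^+10*N^+5 - q^+10*N^+6; - q^+2*N - q^+2*N^+2 - q^+3*N^+2 - q^+4*N^+2 -
        q^+4*N^+3 + 2*q^+5*N^+3 + 2*q^+5*N^+4 + 2*q^+6*N^+4 + 2*q^+7*N^+4 + 2*q^+7*N^+5 -
        q^+8*N^+5 - q^+8*N^+6 - q^+9*N^+6 - q^+10*N^+6 - q^+10*N^+7; - q^+2*N^+2 - q^+2*N^+3
        - q^+3*N^+3 - q^+4*N^+4 + 2*q^+5*N^+4 + q^+5*N^+5 + q^+6*N^+5 + q^+7*N^+6 -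
        q^+8*N^+6];
      [:: - q^+3*N - q^+4*N^+2 - q^+5*N - 2*q^+5*N^+2 - q^+7*N^+2 + q^+7*N^+4 + q^+8*N^+3 +
        2*q^+8*N^+4 - q^+9*N^+3 + q^+9*N^+5 + q^+12*N^+5 + q^+13*N^+6; 1 + q*N + q^+2*N -
        q^+2*N^+2 - q^+3*N - q^+3*N^+2 - q^+3*N^+3 - 3*q^+4*N^+3 - q^+5*N^+2 - q^+5*N^+4 +
        q^+6*N^+3 - q^+6*N^+4 + q^+7*N^+3 + 2*q^+7*N^+4 + 2*q^+8*N^+4 - q^+8*N^+5 +
        q^+9*N^+4 + q^+9*N^+5 - 2*q^+10*N^+6 + q^+11*N^+5 + q^+12*N^+6 - q^+12*N^+7 +
        q^+13*N^+7; N + q*N^+2 - q^+3*N^+2 - q^+3*N^+3 - q^+4*N^+3 - q^+4*N^+4 + q^+6*N^+4 +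
        q^+7*N^+5];
      [:: - q^+6*N - q^+7*N^+2 - q^+8*N^+2 - q^+10*N^+3 + q^+10*N^+4 + q^+12*N^+5 +
        q^+13*N^+5 + q^+14*N^+6; q^+4*N + q^+5*N^+2 + q^+6*N^+2 + q^+8*N^+3 - q^+8*N^+4 -
        q^+10*N^+5 - q^+11*N^+5 - q^+12*N^+6]] (rel1 N f g) k +
  act [:: [:: - q^+5*N^+2 + q^+6*N^+2 + q^+7*N^+3 + q^+8*N^+3 + 2*q^+8*N^+4 - q^+9*N^+4 -
        q^+10*N^+5 - q^+11*N^+5 - q^+11*N^+6; q^+4*N^+2 + q^+5*N^+3 + 2*q^+6*N^+3 +
        q^+6*N^+4 + q^+7*N^+4 + q^+8*N^+4 - 2*q^+9*N^+5 - q^+9*N^+6 - 2*q^+10*N^+6 -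
        q^+11*N^+6 - q^+11*N^+7];
      [:: - q^+6*N - q^+6*N^+2 - q^+8*N^+2 + 2*q^+9*N^+3 + 2*q^+9*N^+4 - q^+10*N^+3 +
        q^+10*N^+4 + q^+11*N^+4 + q^+11*N^+5 - q^+12*N^+5 - q^+12*N^+6 + q^+13*N^+5 -
        q^+13*N^+6 - q^+14*N^+7; - q^+2*N - 2*q^+3*N^+2 - 2*q^+4*N^+2 - q^+4*N^+3 + q^+5*N +
        q^+5*N^+2 - 3*q^+5*N^+3 + q^+6*N^+2 - q^+6*N^+3 - q^+6*N^+4 + q^+7*N^+2 +
        2*q^+7*N^+3 - q^+7*N^+4 + q^+9*N^+3 + 2*q^+10*N^+4 - 2*q^+10*N^+5 + q^+11*N^+4 +
        2*q^+11*N^+5 - q^+11*N^+6 + 2*q^+12*N^+5 + q^+13*N^+6];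
      [:: q^+5*N + q^+6*N^+2 - q^+7*N - q^+8*N^+2 - q^+8*N^+3 - q^+9*N^+2 - q^+9*N^+3 -
        q^+9*N^+4 + q^+10*N^+3 - q^+11*N^+3 + q^+11*N^+4 + q^+12*N^+4 + q^+12*N^+5 +
        q^+14*N^+5; q^+5*N + q^+6*N + q^+6*N^+2 + 2*q^+7*N^+2 - q^+9*N^+3 - q^+9*N^+4 -
        2*q^+10*N^+4 - q^+11*N^+5]] (rel2 N f g) k +
  act [:: [:: - q^+4*N^+2 + q^+5*N^+2 - q^+5*N^+3 + 2*q^+6*N^+3 + q^+7*N^+3 + 3*q^+7*N^+4 +
        2*q^+8*N^+5 - 2*q^+9*N^+5 - q^+10*N^+5 - 2*q^+10*N^+6 - q^+11*N^+6 - q^+11*N^+7];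
      [:: - q^+4*N - q^+4*N^+2 - 2*q^+5*N^+2 - q^+5*N^+3 - 2*q^+6*N^+3 + 2*q^+7*N^+3 +
        3*q^+8*N^+4 + q^+8*N^+5 + 2*q^+9*N^+5 - q^+10*N^+5 + q^+10*N^+6 - q^+11*N^+6]] (rel3
        N f) k +
  act [:: [:: - q^+2*N^+2 - q^+2*N^+3 - 2*q^+3*N^+3 - q^+3*N^+4 - 2*q^+4*N^+4 + 2*q^+5*N^+4
        + 3*q^+6*N^+5 + q^+6*N^+6 + 2*q^+7*N^+6 - q^+8*N^+6 + q^+8*N^+7 - q^+9*N^+7];
      [:: N + 2*q*N^+2 + q^+2*N^+3 - q^+3*N^+2 - q^+3*N^+3 - 2*q^+4*N^+3 - 2*q^+4*N^+4 -
        q^+5*N^+4 - q^+5*N^+5 + q^+6*N^+4 + 2*q^+7*N^+5 + q^+8*N^+6]] (rel4 N f) k +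
  act [:: [:: - q^+5*N - q^+6*N^+2 - q^+7*N^+2 - q^+8*N^+3 - q^+9*N^+3 - q^+10*N^+4; q^+4*N
        + q^+5*N^+2 - q^+10*N^+4 - q^+11*N^+5; q^+5*N^+2 + q^+6*N^+3 + q^+7*N^+3 + q^+8*N^+4
        + q^+9*N^+4 + q^+10*N^+5];
      [:: q^+4 + q^+5*N - q^+10*N^+2 - q^+10*N^+3 - q^+11*N^+3 - q^+11*N^+4 - q^+12*N^+3 -
        q^+13*N^+4 - q^+14*N^+4 - q^+15*N^+5; - q^+2 - q^+3 - q^+3*N - 2*q^+4*N - q^+5*N^+2
        - q^+6*N^+2 - q^+7*N^+3 + q^+9*N^+3 + q^+10*N^+4; q + q^+2*N + q^+3*N + q^+4*N^+2 +
        q^+5*N^+2 + q^+6*N^+3 + q^+8*N^+2 + q^+9*N^+3 + q^+10*N^+3 + q^+11*N^+4 + q^+12*N^+4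
        + q^+13*N^+5];
      [:: q^+5 + q^+6*N + q^+7*N + q^+8*N^+2 + q^+9*N + q^+9*N^+2 + q^+10*N^+2 + q^+10*N^+3
        - q^+15*N^+4 - q^+16*N^+5; - q^+4 - q^+5 - q^+5*N - 2*q^+6*N - q^+7*N - q^+7*N^+2 -
        q^+8*N - 2*q^+8*N^+2 - 2*q^+9*N^+2 - q^+9*N^+3 - q^+10*N^+3 + q^+14*N^+4 +
        q^+15*N^+5; q^+4 + q^+5*N + q^+6*N + q^+7*N^+2 + q^+8*N^+2 + q^+9*N^+3];
      [:: q^+10*N + q^+11*N^+2 + q^+12*N^+2 + q^+13*N^+3 + q^+14*N^+3 + q^+15*N^+4; - q^+9*N
        - q^+10*N^+2 - q^+11*N^+2 - q^+12*N^+3 - q^+13*N^+3 - q^+14*N^+4]] (resT N f g h) k.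
Proof.
rewrite /opB /resT /rel1 /rel2 /rel3 /rel4 /opA /opB /kp1 /kp2 /kp0 /= /opY /=.
by ring.
Qed.

Lemma closure2 N f g h k :
  q^+3*N * (1 + q^+2*N + q^+4*N^+2) * (1 - q^+8*N^+3) * opB (rel2 (q * N) g h) k =
  act [:: [:: - q^+3*N + q^+6*N^+2 + q^+6*N^+3 - q^+9*N^+4; 1 - q*N - 2*q^+3*N^+2 + q^+4*N^+3
        + q^+6*N^+4 + q^+7*N^+3 - q^+10*N^+5; N - q^+3*N^+3 - q^+4*N^+2 - q^+6*N^+3 +
        2*q^+7*N^+4 + q^+9*N^+5 - q^+10*N^+6; q*N^+2 - q^+4*N^+3 - q^+4*N^+4 + q^+7*N^+5];
      [:: q^+3 + q^+5*N - q^+6*N^+2 + q^+7*N^+2 - q^+8*N^+3 - q^+10*N^+4; q^+3*N + q^+4*N^+2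
        + q^+5*N^+2 + q^+6*N^+3 + q^+7*N^+3 - q^+8*N^+2 + q^+8*N^+4 - q^+9*N^+3 - q^+10*N^+3
        - q^+11*N^+4 - q^+12*N^+4 - q^+13*N^+5; q^+6*N^+2 + q^+8*N^+3 - q^+9*N^+4 +
        q^+10*N^+4 - q^+11*N^+5 - q^+13*N^+6]] (rel1 N f g) k +
  act [:: [:: - q^+4*N + q^+7*N^+2 + q^+7*N^+3 - q^+10*N^+4; - q^+2*N - q^+4*N^+2 +
        q^+5*N^+3 - q^+6*N^+2 + q^+7*N^+4 + q^+9*N^+4; q*N + q^+3*N^+2 - q^+4*N^+3 -
        q^+6*N^+4 + q^+8*N^+4 - q^+11*N^+6];
      [:: q^+4 - 2*q^+7*N^+2 + q^+10*N^+4; q^+4*N + q^+5*N + q^+6*N^+2 + q^+7*N^+2 -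
        q^+8*N^+2 - q^+9*N^+2 - q^+10*N^+3 - q^+10*N^+4 - q^+11*N^+3 + q^+11*N^+4 -
        q^+13*N^+4 + q^+13*N^+5; q^+7*N^+2 + q^+8*N^+2 + q^+9*N^+3 - q^+10*N^+4 - q^+11*N^+4
        - q^+12*N^+5]] (rel2 N f g) k +
  act [:: [:: - q^+3*N - q^+4*N^+2 + q^+6*N^+2 + q^+6*N^+3 + q^+7*N^+3 + q^+7*N^+4 -
        q^+9*N^+4 - q^+10*N^+5; - q^+5*N^+2 - q^+5*N^+3 - q^+6*N^+3 - q^+7*N^+4 +
        2*q^+8*N^+4 + q^+8*N^+5 + q^+9*N^+5 + q^+10*N^+6 - q^+11*N^+6]] (rel3 N f) k +
  act [:: [:: N - q*N - q^+2*N^+2 - q^+3*N^+2 - 2*q^+3*N^+3 + q^+4*N^+3 + q^+5*N^+4 +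
        q^+6*N^+4 + q^+6*N^+5; q*N^+2 + q^+2*N^+3 - q^+4*N^+3 - q^+4*N^+4 - q^+5*N^+4 -
        q^+5*N^+5 + q^+7*N^+5 + q^+8*N^+6]] (rel4 N f) k +
  act [:: [:: q^+7*N + q^+9*N^+2 + q^+11*N^+3; - q^+2 - q^+4*N - q^+6*N - q^+6*N^+2 +
        q^+12*N^+4; q - q^+7*N^+2 - q^+7*N^+3 - q^+9*N^+3 - q^+11*N^+4; q^+2*N + q^+4*N^+2 +
        q^+6*N^+3];
      [:: - q^+6 + q^+12*N^+3; - q^+8*N + q^+11*N^+2 + q^+13*N^+3 + q^+14*N^+4 + q^+15*N^+4;
        q^+4 - q^+9*N^+2 - q^+10*N^+2 - q^+10*N^+3 - q^+11*N^+3 - q^+12*N^+3 - q^+13*N^+4 -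
        q^+14*N^+4; q^+6*N + q^+8*N^+2 + q^+10*N^+3];
      [:: - q^+7 - q^+9*N - q^+11*N^+2; q^+6 + q^+8*N + q^+10*N^+2 + q^+13*N^+2 + q^+15*N^+3
        + q^+17*N^+4; - q^+12*N^+2 - q^+14*N^+3 - q^+16*N^+4]] (resT N f g h) k.
Proof.
rewrite /opB /resT /rel1 /rel2 /rel3 /rel4 /opA /opB /kp1 /kp2 /kp0 /= /opY /=.
by ring.
Qed.

Lemma closure3 N f g k :
  q^+3*N * (1 + q^+2*N + q^+4*N^+2) * rel3 (q * N) g k =
  act [:: [:: - q^+2 - q^+3 + q^+3*N + q^+5*N^+2; - 1 - q - q^+2 - q^+2*N - q^+3*N + q^+3*N^+2
        - q^+4*N + q^+4*N^+2 + q^+5*N^+2; - N - q*N - q^+2*N];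
      [:: 0; q^+3 + q^+5*N + q^+7*N^+2]] (rel1 N f g) k +
  act [:: [:: - q^+4 + q^+4*N + q^+5*N + q^+6*N^+2 + q^+7*N^+2; q^+4*N^+2 + q^+5*N^+2 +
        q^+6*N^+2];
      [:: - q^+5*N - q^+6*N - q^+7*N; q^+4 + q^+5 - q^+5*N - q^+7*N^+2]] (rel2 N f g) k +
  act [:: [:: - q^+3 + q^+4*N^+2 + q^+5*N^+2 + q^+6*N^+2 + q^+6*N^+3]] (rel3 N f) k +
  act [:: [:: - N - q*N - q*N^+2 - q^+2*N - q^+2*N^+2 - q^+3*N^+2]] (rel4 N f) k.
Proof.
rewrite /opB /resT /rel1 /rel2 /rel3 /rel4 /opA /opB /kp1 /kp2 /kp0 /= /opY /=.
by ring.
Qed.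

Lemma closure4 N f g k :
  N * (1 + q^+2*N + q^+4*N^+2) * rel4 (q * N) g k =
  act [:: [:: q^+3*N + q^+4*N + q^+5*N; - 1 - q + q*N - q^+2 + q^+2*N + q^+3*N + q^+3*N^+2 +
        q^+4*N^+2 + q^+5*N^+2; - 1 - q^+2*N + q^+2*N^+2 + q^+3*N^+2];
      [:: - q^+3 - q^+5*N - q^+7*N^+2]] (rel1 N f g) k +
  act [:: [:: q^+4*N + q^+5*N + q^+6*N; q^+2*N + q^+3*N + q^+4*N + q^+4*N^+2 + q^+5*N^+2 +
        q^+6*N^+2; 1 + q^+2*N + q^+4*N^+2];
      [:: - q^+4 - q^+5 - q^+6*N - q^+7*N + q^+7*N^+2; - q^+5*N - q^+6*N - q^+7*N]] (rel2 N
        f g) k +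
  act [:: [:: q^+3*N + q^+4*N + q^+4*N^+2 + q^+5*N + q^+5*N^+2 + q^+6*N^+2]] (rel3 N f) k +
  act [:: [:: - 1 - N - q*N - q^+2*N + q^+3*N^+3]] (rel4 N f) k.
Proof.
rewrite /opB /resT /rel1 /rel2 /rel3 /rel4 /opA /opB /kp1 /kp2 /kp0 /= /opY /=.
by ring.
Qed.

End SkewOperators.

(** * Construction and vanishing of the tails *)

Section Tails.
Variables (F : fieldType) (q : F).
Hypothesis q0 : q != 0.
Hypothesis qn1 : forall n, (0 < n)%N -> q ^+ n != 1.

(* Index k stands for the exponent k - 8: tails are extended by zero to a few negative
   exponents so that the relations hold without boundary terms. *)
Notation z := (q ^- 8).
Notation qsh := (qshift q z).

Lemma qshiftE k : qsh k = q ^+ k * z.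
Proof.
elim: k => [|k IH].
  by rewrite mul1r.
by rewrite (exprS q k) /= IH mulrA.
Qed.

Lemma qshift_neq0 k : qsh k != 0.
Proof. by rewrite qshiftE mulf_neq0 ?invr_neq0 ?expf_neq0. Qed.

Lemma sub_neq0 n : (0 < n)%N -> 1 - q ^+ n != 0.
Proof. by move=> n0; rewrite subr_eq0 eq_sym qn1. Qed.

Lemma one_add_neq0 n : (0 < n)%N -> 1 + q ^+ n != 0.
Proof.
move=> n0; apply/eqP => e.
have /eqP : (1 - q ^+ (n * 2)) = 0.
  by rewrite exprM; transitivity ((1 - q ^+ n) * (1 + q ^+ n)); [ring|rewrite e mulr0].
by apply/negP/sub_neq0; lia.
Qed.

Lemma one_add2_neq0 n : (0 < n)%N -> 1 + q ^+ n + q ^+ n ^+ 2 != 0.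
Proof.
move=> n0; apply/eqP => e.
have /eqP : (1 - q ^+ (n * 3)) = 0.
  rewrite exprM; transitivity ((1 - q ^+ n) * (1 + q ^+ n + q ^+ n ^+ 2)); first ring.
  by rewrite e mulr0.
by apply/negP/sub_neq0; lia.
Qed.

Lemma mulf_eq0_r (a b : F) : a != 0 -> a * b = 0 -> b = 0.
Proof. by move=> a0 /eqP; rewrite mulf_eq0 (negPf a0) => /eqP. Qed.

Lemma opBE u k : opB q z u k = qsh k * (u k.+1 + q * u k.+2).
Proof. by rewrite /opB /= /opY /=; ring. Qed.

(** On the kernel of B, u (k+1) = - q u (k+2), so [u 1 = 0] propagates upwards. *)
Lemma opB_inj u : u 0 = 0 -> u 1 = 0 -> (forall k, opB q z u k = 0) -> forall k, u k = 0.
Proof.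
move=> u0 u1 uB; suff H k : u k = 0 /\ u k.+1 = 0 by move=> k; case: (H k).
elim: k => [//|k [_ uk1]]; split=> //; apply/eqP.
move: (uB k) => /eqP; rewrite opBE uk1 add0r !mulf_eq0.
by rewrite (negPf (qshift_neq0 k)) (negPf q0).
Qed.

(** The recurrence solved for its last sequence: by [opBE] it gives the value at k+2 from the one at
    k+1, started with zeros at 0 and 1. *)
Fixpoint nextf (N : F) (f g : nat -> F) k : F :=
  if k is k'.+1 then
    if k' is k''.+1 then
      ((kp1 q N * opB q z f k'' - kp0 q N * opA q z g k'') / (kp2 q N * qsh k'')
        - nextf N f g k') / q
    else 0
  else 0.

Lemma resT_nextf N f g k : kp2 q N != 0 -> resT q z N f g (nextf N f g) k = 0.
Proof.
move=> k2; rewrite /resT opBE.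
have -> : nextf N f g k.+2 = ((kp1 q N * opB q z f k - kp0 q N * opA q z g k) / (kp2 q N * qsh k)
   - nextf N f g k.+1) / q by [].
move: (nextf N f g k.+1) (opB q z f k) (opA q z g k) (qshift_neq0 k) => a b c.
by move: (qsh k) (kp1 q N) (kp0 q N) (kp2 q N) k2 => ? ? ? ? ? ?; field; rewrite q0; apply/and3P.
Qed.

Definition vanish n (f : nat -> F) := forall k, (k <= n + 8)%N -> f k = 0.

Definition ladder N f g :=
  [/\ forall k, rel1 q z N f g k = 0, forall k, rel2 q z N f g k = 0,
      forall k, rel3 q z N f k = 0 & forall k, rel4 q z N f k = 0].

Lemma eq_opX (cs : seq F) u v k : (forall j, u j = v j) -> opX cs u k = opX cs v k.
Proof. by move=> uv; elim: cs k => //= c cs IH k; rewrite IH uv. Qed.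

Lemma eq_act css (u v : nat -> F) k : (forall j, u j = v j) -> act q z css u k = act q z css v k.
Proof.
move=> uv; elim: css k => //= cs css IH k.
by rewrite (eq_opX _ _ uv) /opY !IH.
Qed.

Lemma act0 css (u : nat -> F) k : (forall j, u j = 0) -> act q z css u k = 0.
Proof.
move=> u0; rewrite (eq_act _ _ u0).
have X0 (cs : seq F) l : opX cs (fun=> 0) l = 0.
  by elim: cs l => //= c cs IH l; rewrite IH mulr0 addr0.
by elim: css k => //= cs css IH k; rewrite X0 /opY !IH !(mulr0, addr0).
Qed.

Lemma ladder_step N f g h :
    N != 0 -> 1 + q * N != 0 -> 1 + q^+2 * N + q^+4*N^+2 != 0 -> 1 - q^+8*N^+3 != 0 ->
    vanish 0 g -> vanish 0 h -> (forall k, resT q z N f g h k = 0) ->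
  ladder N f g -> ladder (q * N) g h.
Proof.
move=> N0 N1 N2 N3 g0 h0 fT [r1 r2 r3 r4].
have small r : (forall k, opB q z r k = 0) -> r 0 = 0 -> r 1 = 0 -> forall k, r k = 0.
  by move=> ? ? ?; apply: opB_inj.
split=> k.
- move: k; apply: small => [k||]; last 2 first.
  + by rewrite /rel1 /= /opY /= !(g0, h0) //; ring.
  + by rewrite /rel1 /= /opY /= !(g0, h0) //; ring.
  apply: (mulf_eq0_r _ (etrans (closure1 q z N f g h k) _)); last by rewrite !act0 // !addr0.
  by rewrite !mulf_neq0 // expf_neq0.
- move: k; apply: small => [k||]; last 2 first.
  + by rewrite /rel2 /= /opY /= !(g0, h0) //; ring.
  + by rewrite /rel2 /= /opY /= !(g0, h0) //; ring.
  apply: (mulf_eq0_r _ (etrans (closure2 q z N f g h k) _)); last by rewrite !act0 // !addr0.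
  by rewrite !mulf_neq0 // expf_neq0.
- apply: (mulf_eq0_r _ (etrans (closure3 q z N f g k) _)); last by rewrite !act0 // !addr0.
  by rewrite !mulf_neq0 // expf_neq0.
- apply: (mulf_eq0_r _ (etrans (closure4 q z N f g k) _)); last by rewrite !act0 // !addr0.
  by rewrite !mulf_neq0 // expf_neq0.
Qed.

(** At index k the recurrence reads f up to k+2 and g up to k+3, so it yields zeros up to exponent
    n. The two further ones come from [vanish_step]. *)
Lemma nextf_vanish0 n N f g : vanish n f -> vanish n.+1 g -> vanish n (nextf N f g).
Proof.
move=> f0 g0 k; elim/ltn_ind: k => -[//|[//|k]] IH kn.
rewrite [LHS]/= -/(nextf N f g k.+1) IH //; last by lia.
rewrite opBE !f0 ?g0; try lia.
rewrite /opA /= /opY /= !g0; try lia.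
by rewrite !(mulr0, addr0, mul0r, subr0).
Qed.

(* The symbol of [lb1] at the bottom of the tail is nonzero, so [rel1] forces two
   further zeros: at the first one [g] drops out, at the second the symbol of [la1]
   vanishes. *)
Lemma vanish_step n f g h :
    vanish n f -> vanish n.+1 g -> vanish n h ->
    (forall k, rel1 q z (q ^+ n.+1) g h k = 0) ->
  vanish n.+2 h.
Proof.
move=> f0 g0 h0 r1.
have nz i : 1 - q ^+ 5 * q ^+ n.+1 * qsh (n + 5 + i)%N != 0.
  rewrite qshiftE; have -> : q ^+ 5 * q ^+ n.+1 * (q ^+ (n + 5 + i) / q ^+ 8) =
    q ^+ (n + n + i + 3).
    by rewrite !exprD (exprS q n); field.
  by apply: sub_neq0; lia.
have nzC i : q ^+ 7 * q ^+ n.+1 * qsh (n + 5 + i)%N ^+ 2 *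
    (1 - q ^+ 5 * q ^+ n.+1 * qsh (n + 5 + i)%N) != 0.
  by rewrite !mulf_neq0 ?expf_neq0 ?qshift_neq0 // -exprS expf_neq0.
have v1 : h (n + 9)%N = 0.
  apply: (mulf_eq0_r (nzC 0)); rewrite -(r1 (n + 5)%N) addn0 /rel1 /= /opY /=.
  rewrite !(g0, h0 (n+5)%N, h0 (n+5).+1, h0 (n+5).+2, h0 (n+5).+3); try lia.
  have -> : (n + 9 = (n + 5).+4)%N by lia.
  ring.
have v2 : h (n + 10)%N = 0.
  apply: (mulf_eq0_r (nzC 1)); rewrite -(r1 (n + 6)%N) /rel1.
  have -> : (n + 10 = (n + 6).+4)%N by lia.
  have -> : (n + 5 + 1 = n + 6)%N by lia.
  rewrite /= /opY /=.
  have gE i : (i <= 3)%N -> g (i + (n + 6))%N = 0 by move=> ?; apply: g0; lia.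
  rewrite !(gE 0, gE 1, gE 2, gE 3) //.
  have h9 : h (n + 6).+3 = 0 by rewrite -v1; congr h; lia.
  rewrite !(h9, h0 (n+6)%N, h0 (n+6).+1, h0 (n+6).+2); try lia.
  move: (qshiftE (n + 6)); rewrite exprD => ->; rewrite (exprS q n).
  by move: (q ^+ n) => x; field.
move=> k kn; have [kn8|nk] := leqP k (n + 8); first exact: h0.
have [->|k9] := eqVneq k (n + 9)%N; first exact: v1.
by have -> : k = (n + 10)%N by lia.
Qed.

Fixpoint qinv k : F := if k is k'.+1 then q^-1 * qinv k' else 1.

Lemma qinvE k : qinv k = (q ^+ k)^-1.
Proof. by elim: k => [|k /= ->]; [rewrite invr1|rewrite exprS invfM]. Qed.

(** Value at z^(k+1) of the functional with e_m -> (-1)^m, an eigenvector of Y for -1; see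
    [pe_wseq]. *)
Fixpoint wseq k : F :=
  if k is k'.+1 then - (1 + qinv k'.+1) / q * wseq k' else - q^-1.

(** Value at z^(k+1) of the functional with e_1 -> 1 and e_m -> 0 for m > 1, which Y kills; see
    [pe_vseq]. *)
Fixpoint vseq k : F := if k is k'.+1 then - vseq k' / q else q^-1.

(** Tail of the explicit data s = 1, t_m = (-1)^(m-1) of [Sdata0]. *)
Definition tail0 k : F := if k is k'.+1 then 2%:R - 2%:R * wseq k' else 0.

(** Normalization of the data for n = 1 with which [ladder0] holds. *)
Definition scale1 : F := - (1 - q) / (1 - q ^+ 5).

(** Tail of the data in [Sdata1], scaled. *)
Definition tail1 k : F :=
  if k is k'.+1 then scale1 *
    (2%:R * (1 + q) * (1 + wseq k') - 2%:R * q * (k' == 0)%:R + 2%:R * vseq k')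
  else 0.

Definition pad (u : nat -> F) k := if k is k'.+4.+4 then u k' else 0.

Fixpoint tail n : nat -> F :=
  if n is n'.+1 then
    if n' is n''.+1 then nextf (q ^+ n'') (tail n'') (tail n') else pad tail1
  else pad tail0.

(** The first ten indices cover the padding and the exceptional term of [tail1]. Beyond them
    everything is affine in [wseq k] and [vseq k] with coefficients rational in q and q^k. *)
Lemma ladder0 : ladder 1 (pad tail0) (pad tail1).
Proof.
have q5 : 1 - q ^+ 5 != 0 by apply: sub_neq0.
split=> k.
- do 10?[case: k => [|k]].
  1-10: by rewrite /rel1 /tail0 /tail1 /scale1 /= /opY /=; field; rewrite ?q0 ?q5.
  rewrite /rel1 /tail0 /tail1 /scale1 /= /opY /= qshiftE qinvE.
  move: (wseq k) (vseq k) (q ^+ k) (expf_neq0 k q0) => w v x x0.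
  by field; rewrite ?q0 ?x0 ?q5.
- do 10?[case: k => [|k]].
  1-10: by rewrite /rel2 /tail0 /tail1 /scale1 /= /opY /=; field; rewrite ?q0 ?q5.
  rewrite /rel2 /tail0 /tail1 /scale1 /= /opY /= qshiftE qinvE.
  move: (wseq k) (vseq k) (q ^+ k) (expf_neq0 k q0) => w v x x0.
  by field; rewrite ?q0 ?x0 ?q5.
- do 10?[case: k => [|k]].
  1-10: by rewrite /rel3 /tail0 /tail1 /scale1 /= /opY /=; field; rewrite ?q0 ?q5.
  rewrite /rel3 /tail0 /tail1 /scale1 /= /opY /= qshiftE qinvE.
  move: (wseq k) (vseq k) (q ^+ k) (expf_neq0 k q0) => w v x x0.
  by field; rewrite ?q0 ?x0 ?q5.
- do 10?[case: k => [|k]].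
  1-10: by rewrite /rel4 /tail0 /tail1 /scale1 /= /opY /=; field; rewrite ?q0 ?q5.
  rewrite /rel4 /tail0 /tail1 /scale1 /= /opY /= qshiftE qinvE.
  move: (wseq k) (vseq k) (q ^+ k) (expf_neq0 k q0) => w v x x0.
  by field; rewrite ?q0 ?x0 ?q5.
Qed.

Lemma kp2_neq0 n : kp2 q (q ^+ n) != 0.
Proof.
by rewrite /kp2 -!exprM -exprD !mulf_neq0 ?expf_neq0 // sub_neq0.
Qed.

(** Both properties are carried together: [ladder_step] needs zeros at low indices, and
    [vanish_step] needs the first ladder relation. *)
Lemma ladderP n :
  [/\ ladder (q ^+ n) (tail n) (tail n.+1), vanish n (tail n) & vanish n.+1 (tail n.+1)].
Proof.
elim: n => [|n [L v0 v1]].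
  split; first exact: ladder0.
    by do 9?[case=> [//|]].
  do 9?[case=> [//|]] => -[_|k //]; rewrite /= /tail1 /=.
  by have := @sub_neq0 5 isT => q5; field; rewrite ?q0 ?q5.
have v2 : vanish n (tail n.+2) by apply: nextf_vanish0.
have L1 : ladder (q ^+ n.+1) (tail n.+1) (tail n.+2).
  rewrite exprS; apply: (ladder_step (f := tail n)) => //.
  - exact: expf_neq0.
  - by rewrite -exprS one_add_neq0.
  - have := @one_add2_neq0 n.+2 isT; apply: contraNneq => <-.
    by rewrite -addn2 exprD; apply/eqP; ring.
  - by rewrite -exprM -exprD sub_neq0.
  - by move=> k k8; apply: v1; lia.
  - by move=> k k8; apply: v2; lia.
  - by move=> k; apply/resT_nextf/kp2_neq0.
split=> //; apply: (vanish_step v0 v1 v2); by case: L1.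
Qed.

Lemma tail_vanish n : vanish n (tail n).
Proof. by case: (ladderP n). Qed.

Lemma tail_rec n k : resT q z (q ^+ n) (tail n) (tail n.+1) (tail n.+2) k = 0.
Proof. exact/resT_nextf/kp2_neq0. Qed.

End Tails.

(** * The sequences s and t *)

Section Step.
Variables (F : fieldType) (q : F).
Notation qk := (qshift q 1).
Notation Y := (opY q 1).

Lemma qkE k : qk k = q ^+ k.
Proof. by elim: k => [|k /= ->] //; rewrite exprS. Qed.

Definition predseq (a : nat -> F) k := if k is k'.+1 then a k' else 0.

(** On coefficients, the map p(z) -> (1 + q z) p(q z), which takes e_m to e_(m+1); [opY] is its
    transpose. *)
Definition coY (a : nat -> F) k := qk k * (a k + predseq a k).

(* [ep m] is the coefficient sequence of [e_(m+1) = q^(m+1) z \prod_(r <= m) (1 + q^r z)],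
   and [pe g m] is the value at [e_(m+1)] of the functional [z^k |-> g k]. *)
Definition ep m := iter m coY (fun k => q * (k == 1)%:R).

Definition pe (g : nat -> F) m := q * iter m Y g 1.

Lemma peS g m : pe g m.+1 = pe (Y g) m.
Proof. by rewrite /pe iterSr. Qed.

Lemma eq_pe m (g h : nat -> F) :
  (forall k, (0 < k <= m.+1)%N -> g k = h k) -> pe g m = pe h m.
Proof.
elim: m g h => [|m IH] g h gh; first by rewrite /pe /= gh.
rewrite !peS; apply: IH => k km; rewrite /opY !gh //; lia.
Qed.

Lemma peD g h m : pe (fun k => g k + h k) m = pe g m + pe h m.
Proof.
elim: m g h => [|m IH] g h; first by rewrite /pe /= mulrDr.
by rewrite !peS -IH; apply: eq_pe => k _; rewrite /opY; ring.
Qed.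

Lemma peZ a g m : pe (fun k => a * g k) m = a * pe g m.
Proof.
elim: m g => [|m IH] g; first by rewrite /pe /=; ring.
by rewrite !peS -IH; apply: eq_pe => k _; rewrite /opY; ring.
Qed.

Lemma peB g h m : pe (fun k => g k - h k) m = pe g m - pe h m.
Proof.
by rewrite -mulN1r -peZ -peD; apply: eq_pe => k _; rewrite mulN1r.
Qed.

(* The index of [pe], [ep] and of the sums over them is shifted: m stands for e_(m+1).
   [f] is the tail: z^k |-> s_k + s_(k+1) minus e_m |-> t_(m+1) - t_m. *)
Definition Sdata n (s t : nat -> F) h (f : nat -> F) :=
  [/\ s 1 = t 1 /\ t n.+1 = h,
      (forall k, (n < k)%N -> s k = h) /\ (forall m, (n < m)%N -> t m.+1 = - t m),
      forall k, (0 < k)%N ->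
        s k.+1 - s k = \sum_(m < n) (t m.+1 + t m.+2) * ep m k,
      forall m, pe f m = pe (fun k => s k + s k.+1) m - (t m.+2 - t m.+1) &
      forall k, (k <= n)%N -> f k = 0].

Lemma SdataZ a n s t h f : Sdata n s t h f ->
  Sdata n (fun k => a * s k) (fun k => a * t k) (a * h) (fun k => a * f k).
Proof.
case=> -[s1 tn] [sk tk] st ft f0; split; first by rewrite s1 tn.
- split=> [k nk|m nm]; first by rewrite sk.
  by rewrite tk // mulrN.
- move=> k k0; rewrite -mulrBr st // mulr_sumr; apply: eq_bigr => i _; ring.
- move=> m; rewrite peZ ft; transitivity (a * pe (fun k => s k + s k.+1) m
    - (a * t m.+2 - a * t m.+1)); first by ring.
  by rewrite -peZ; congr (_ - _); apply: eq_pe => k _; rewrite mulrDr.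
- by move=> k kn; rewrite f0 ?mulr0.
Qed.

Lemma eq_Sdata n s t h f g :
  (forall k, f k = g k) -> Sdata n s t h f -> Sdata n s t h g.
Proof.
move=> fg [st sk cd ft f0]; split=> // [m|k kn]; last by rewrite -fg f0.
by rewrite -ft; apply: eq_pe => k _; rewrite fg.
Qed.

Lemma ep0 m : ep m 0 = 0.
Proof. by elim: m => [|m IH] /=; rewrite /ep /= ?mulr0 // /coY -/(ep m) IH addr0 mulr0. Qed.

Lemma ep1 m : ep m 1 = qk m.+1.
Proof.
elim: m => [|m IH]; first by rewrite /ep /=; ring.
by rewrite -[ep m.+1]/(coY (ep m)) /coY /= IH ep0 /=; ring.
Qed.

Lemma epS m k : ep m.+1 k = coY (ep m) k.
Proof. by []. Qed.

Lemma ep_large m k : (m.+1 < k)%N -> ep m k = 0.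
Proof.
elim: m k => [|m IH] [|k] // mk; first by case: k mk => //= k _; rewrite /ep /= mulr0.
rewrite epS /coY /= !IH ?addr0 ?mulr0 //; lia.
Qed.

Definition esum (a : nat -> F) K k := \sum_(m < K) a m * ep m k.

Lemma esum_widen a K L k : (K <= L)%N -> (forall m, (K <= m)%N -> a m = 0) ->
  esum a L k = esum a K k.
Proof.
move=> KL a0; rewrite /esum (big_ord_widen _ (fun m => a m * ep m k) KL) [RHS]big_mkcond /=.
by apply: eq_bigr => m _; case: ltnP => // /a0->; rewrite mul0r.
Qed.

Lemma esumD a b K k : esum (fun m => a m + b m) K k = esum a K k + esum b K k.
Proof. by rewrite /esum -big_split; apply: eq_bigr => m _; rewrite mulrDl. Qed.

Lemma esumZ x a K k : esum (fun m => x * a m) K k = x * esum a K k.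
Proof. by rewrite /esum mulr_sumr; apply: eq_bigr => m _; rewrite mulrA. Qed.

Lemma esumY a K k : coY (esum a K) k = esum (predseq a) K.+1 k.
Proof.
have pE : predseq (esum a K) k = \sum_(m < K) a m * predseq (ep m) k.
  by case: k => [|k] //=; rewrite big1 // => m _; rewrite mulr0.
rewrite [RHS]/esum big_ord_recl mul0r add0r /coY pE /esum -big_split mulr_sumr.
by apply: eq_bigr => m _; rewrite lift0 epS /coY /=; ring.
Qed.

Lemma eq_coY a b k : (forall j, a j = b j) -> coY a k = coY b k.
Proof. by move=> ab; rewrite /coY ab; case: k => //= k; rewrite ab. Qed.

Hypothesis q0 : q != 0.

Lemma qk_neq0 k : qk k != 0.
Proof. by rewrite qkE expf_neq0. Qed.

(** Transpose of z e_m = q^-(m+1) e_(m+1) - q^-m e_m, which is the product formula for e_(m+1).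
    [ep_pred] is the same identity on coefficients. *)
Lemma pe_shift g m :
  pe (fun k => g k.+1) m = (qk m.+2)^-1 * pe g m.+1 - (qk m.+1)^-1 * pe g m.
Proof.
elim: m g => [|m IH] g.
  by rewrite /pe /= /opY /=; field; rewrite q0.
rewrite !(peS g) peS.
transitivity (q^-1 * pe (fun k => Y g k.+1) m).
  rewrite -peZ; apply: eq_pe => k _; rewrite /opY /=.
  by field.
rewrite IH /=; field; rewrite ?q0 ?qk_neq0 //.
Qed.

Lemma ep_pred m k :
  ep m k = (qk m.+2)^-1 * ep m.+1 k.+1 - (qk m.+1)^-1 * ep m k.+1.
Proof.
elim: m k => [|m IH] k.
  rewrite epS /coY /ep /=.
  case: k => [|[|k]] /=; field; rewrite ?q0 ?qk_neq0 //.
have IHp : predseq (ep m) k =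
    (qk m.+2)^-1 * predseq (ep m.+1) k.+1 - (qk m.+1)^-1 * predseq (ep m) k.+1.
  case: k => [|k]; last exact: IH.
  by rewrite /predseq !ep0 !mulr0 subrr.
rewrite epS /coY IHp IH (epS m.+1) (epS m k.+1) /coY /=.
rewrite (_ : coY (ep m) k.+1 = q * qk k * (ep m k.+1 + ep m k)) //.
by field; rewrite q0 ?qk_neq0.
Qed.

Lemma esumX a K k : (forall m, (K <= m)%N -> a m = 0) ->
  esum a K k = esum (fun m => (qk m.+1)^-1 * (predseq a m - a m)) K.+1 k.+1.
Proof.
move=> a0; transitivity (esum (fun m => (qk m.+1)^-1 * predseq a m) K.+1 k.+1 -
   esum (fun m => (qk m.+1)^-1 * a m) K.+1 k.+1); last first.
  by rewrite -mulN1r -esumZ -esumD; apply: eq_bigr => m _; ring.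
rewrite [X in _ = _ - X]/esum big_ord_recr /= a0 // mulr0 mul0r addr0.
rewrite /esum big_ord_recl mulr0 mul0r add0r -sumrB.
by apply: eq_bigr => m _; rewrite lift0 ep_pred /=; ring.
Qed.

(** [XA], [opBe] and [opAe] are X, B and q^-2 A acting on the values of a functional at the e_m,
    where Y is the index shift. *)
Definition XA (g : nat -> F) m := (qk m.+2)^-1 * g m.+1 - (qk m.+1)^-1 * g m.

Definition opBe (g : nat -> F) m := XA g m.+1.

Definition opAe (g : nat -> F) m :=
  g m.+1 + g m.+2 - XA g m.+2 - XA (XA g) m.+1 + (q^+2)^-1 * (XA g m - XA (XA g) m).

Lemma pe_opB g m : pe (opB q 1 g) m = opBe (pe g) m.
Proof.
rewrite /opBe /XA -pe_shift peS; apply: eq_pe => k _.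
by rewrite /opB /= /opY /=; ring.
Qed.

Lemma pe_opA g m : pe (fun k => (q^+2)^-1 * opA q 1 g k) m = opAe (pe g) m.
Proof.
have XE j : XA (pe g) j = pe (fun k => g k.+1) j by rewrite pe_shift.
have XXE j : XA (XA (pe g)) j = pe (fun k => g k.+2) j.
  by rewrite [RHS](pe_shift (fun k => g k.+1)) -!XE.
rewrite /opAe !XE !XXE !peS -peB -peZ -peD -!peB -peD.
apply: eq_pe => k _; rewrite /opA /= /opY /=.
by field.
Qed.

Lemma opBeE g m : opBe g m = (qk m.+3)^-1 * g m.+2 - (qk m.+2)^-1 * g m.+1.
Proof. by []. Qed.

(* With p = \sum_k (s_(k+1) - s_k) z^k = \sum_m (t_m + t_(m+1)) e_m the data for n+1, the
   next polynomial is obtained from p by the operator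
     X + q^-1 Y + q^-1 X Y^-1 - X^-1 - q^-1 X^-1 Y - q^-1 Y^-1
   where X^-1 kills z and Y^-1 kills e_1, up to a multiple of z.  Here [uu] is Y^-1 p in the
   basis z^k, [ww] is X^-1 p in the basis e_m, and [cx], [dx] are the two expansions of the
   result. *)
Section Core.
Variables (n : nat) (s t : nat -> F) (h : F) (f : nat -> F).
Hypothesis dS : Sdata n.+1 s t h f.

Definition cc k := if k is k'.+1 then s k'.+2 - s k'.+1 else 0.
Definition dd m := t m.+1 + t m.+2.
Definition uu := esum (fun m => dd m.+1) n.
Definition ww m := cc 1 - \sum_(i < m.+1) qk i.+1 * dd i.

Lemma dd_large m : (n < m)%N -> dd m = 0.
Proof. by case: dS => _ [_ tn] _ _ _ nm; rewrite /dd (tn m.+1) ?subrr. Qed.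

Lemma cc_esum k : cc k = esum dd n.+1 k.
Proof.
case: k => [|k]; last by case: dS => _ _ /(_ k.+1 isT).
by rewrite /esum big1 // => m _; rewrite ep0 mulr0.
Qed.

Lemma uuE k : qk k * (uu k + predseq uu k) = cc k - q * (k == 1)%:R * dd 0.
Proof.
rewrite -/(coY uu k) esumY cc_esum /esum !big_ord_recl /= mul0r add0r.
by rewrite /ep /= [in RHS]addrC; ring.
Qed.

Lemma wwS m : ww m.+1 = ww m - qk m.+2 * dd m.+1.
Proof. by rewrite /ww big_ord_recr /= opprD addrA. Qed.

(** [cc 1] is the coefficient of z in p, and by [ep1] the sum in [ww] collects the contributions of
    the e_m to it. *)
Lemma ww_large m : (n <= m)%N -> ww m = 0.
Proof.
elim: m => [|m IH]; rewrite leq_eqVlt => /orP[/eqP|].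
- move=> n0; rewrite /ww cc_esum n0 /esum !big_ord_recl !big_ord0 ep1; ring.
- by [].
- move=> nm; rewrite /ww cc_esum nm /esum -sumrB big1 // => i _.
  by rewrite ep1; ring.
- by move=> nm; rewrite wwS IH // dd_large // mulr0 subr0.
Qed.

(** Multiplying back by z recovers p up to a multiple of e_1 = q z, which is invisible for k > 0. *)
Lemma ww_esum k : (0 < k)%N -> esum ww n k = cc k.+1.
Proof.
move=> k0; rewrite esumX; last exact: ww_large.
rewrite cc_esum; transitivity (esum (fun m => dd m + - cc 1 / q * (m == 0)%:R) n.+1 k.+1).
  apply: eq_bigr => -[[|m] ?] _ /=; last first.
    by rewrite wwS /=; congr (_ * _); field; rewrite q0 qk_neq0.
  by congr (_ * _); rewrite /ww big_ord_recl big_ord0 /=; field.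
rewrite esumD esumZ [X in _ + _ * X](_ : _ = 0) ?mulr0 ?addr0 //.
rewrite /esum big1 // => -[[|m] ?] _ /=; rewrite ?mul0r // mul1r /ep /=.
by case: k k0 => // k _; rewrite mulr0.
Qed.

Definition Xdd m := (qk m.+1)^-1 * (predseq dd m - dd m).

Definition cx lam k :=
  predseq cc k + q^-1 * coY cc k + q^-1 * predseq uu k - cc k.+1
  - q^-1 * coY cc k.+1 - q^-1 * uu k + lam * (k == 1)%:R.

Definition dx lam m :=
  Xdd m + q^-1 * predseq dd m - predseq ww m - q^-1 * dd m.+1 + Xdd m.+1 - ww m
  + q^-1 * (lam - q * cc 1 - q^-1 * dd 0) * (m == 0)%:R.

Lemma esumN a K k : esum (fun m => - a m) K k = - esum a K k.
Proof. by rewrite -mulN1r -esumZ; apply: eq_bigr => m _; rewrite mulN1r. Qed.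

Lemma esum_delta K k : esum (fun m => (m == 0)%:R) K.+1 k = q * (k == 1)%:R.
Proof.
rewrite /esum big_ord_recl big1 /= => [|m _]; last by rewrite mul0r.
by rewrite /ep /=; ring.
Qed.

Lemma cx_esum lam k : (0 < k)%N -> cx lam k = esum (dx lam) n.+2 k.
Proof.
move=> k0; rewrite /dx !esumD !esumN !esumZ esum_delta.
have dd_l m : (n.+1 <= m)%N -> dd m = 0 by move=> ?; apply: dd_large.
have -> : esum Xdd n.+2 k = predseq cc k.
  by case: k k0 => // k _; rewrite -esumX // -cc_esum.
have -> : esum (predseq dd) n.+2 k = coY cc k.
  by rewrite -esumY; apply: eq_coY => j; rewrite cc_esum.
have -> : esum (predseq ww) n.+2 k = q^-1 * coY cc k.+1 - q * cc 1 * (k == 1)%:R.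
  rewrite (esum_widen (K := n.+1)) //; last by case=> //= m; apply: ww_large.
  rewrite -esumY /coY ww_esum //; case: k k0 => // -[_|k _].
    by rewrite /= {1}/esum big1 /= => [|m _]; rewrite ?ep0 ?mulr0 //; field.
  by rewrite /= ww_esum //=; field.
have -> : esum (fun m => dd m.+1) n.+2 k = uu k.
  by apply: esum_widen => [|m nm]; [lia|apply: dd_l; lia].
have -> : esum ww n.+2 k = cc k.+1.
  by rewrite -ww_esum //; apply: esum_widen => [|m]; [lia|apply: ww_large].
have -> : esum (fun m => Xdd m.+1) n.+2 k =
    q^-1 * predseq uu k + (q^+2)^-1 * dd 0 * (q * (k == 1)%:R).
  rewrite (esum_widen (K := n.+1)) //; last first.
    by move=> m nm; rewrite /Xdd /= !dd_l ?subrr ?mulr0 //; lia.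
  case: k k0 => // k _ /=; rewrite /uu [in RHS]esumX; last by move=> m nm; apply: (dd_l m.+1).
  rewrite -(esum_delta n) -!esumZ -esumD; apply: eq_bigr => -[[|m] ?] _ /=.
    by rewrite /Xdd /=; congr (_ * _); field.
  by rewrite /Xdd /=; congr (_ * _); field; rewrite q0 qk_neq0.
by rewrite /cx; field.
Qed.

(** [xx] has differences [cx] and vanishes far out; [yy] has consecutive sums [dx] and starts at
    [xx 1]. In [Sdata_step] the data two steps back is subtracted from them. *)
Definition xx lam k := - \sum_(j < n.+2) cx lam j.+1 + \sum_(j < k.-1) cx lam j.+1.

Lemma xxS lam k : xx lam k.+2 = xx lam k.+1 + cx lam k.+1.
Proof. by rewrite /xx [X in _ + X = _]big_ord_recr /= addrA. Qed.

Lemma esum_large a K k : (K < k)%N -> esum a K k = 0.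
Proof.
move=> Kk; rewrite /esum big1 // => i _; rewrite ep_large ?mulr0 //.
by apply: leq_ltn_trans Kk; rewrite ltn_ord.
Qed.

Lemma cx_large lam k : (n.+2 < k)%N -> cx lam k = 0.
Proof. by move=> nk; rewrite cx_esum ?esum_large //; lia. Qed.

Lemma xx_large lam k : (n.+2 < k)%N -> xx lam k = 0.
Proof.
rewrite /xx => nk; rewrite -(subnK (_ : n.+2 <= k.-1)%N); last lia.
rewrite addnC big_split_ord /= addrA addNr add0r big1 // => i _.
by rewrite cx_large //=; lia.
Qed.

Fixpoint yy lam m :=
  if m is m'.+1 then if m' is m''.+1 then dx lam m'' - yy lam m' else xx lam 1 else 0.

Lemma yyS lam m : yy lam m.+2 = dx lam m - yy lam m.+1.
Proof. by []. Qed.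

Lemma dx_large lam m : (n.+2 <= m)%N -> dx lam m = 0.
Proof.
case: m => // m nm; have dd0 j : dd (j + m) = 0 by apply: dd_large; lia.
have ww0 j : ww (j + m) = 0 by apply: ww_large; lia.
rewrite /dx /Xdd /= !(dd0 0, dd0 1, dd0 2, ww0 0, ww0 1).
by rewrite !(subr0, mulr0, addr0).
Qed.

Lemma cx_lam lam k : cx lam k.+1 = cx 0 k.+1 + lam * (k == 0)%:R.
Proof. by rewrite /cx eqSS mul0r addr0. Qed.

Lemma dx_lam lam m : dx lam m = dx 0 m + q^-1 * lam * (m == 0)%:R.
Proof. by rewrite /dx; ring. Qed.

Lemma xx_lam lam : xx lam 1 = xx 0 1 - lam.
Proof.
rewrite /xx !big_ord0 !addr0 -opprD; congr (- _).
under eq_bigr do rewrite cx_lam; rewrite big_split; congr (_ + _).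
by rewrite big_ord_recl big1 /= ?mulr1 ?addr0 // => i _; rewrite mulr0.
Qed.

Hypothesis qn1 : forall n, (0 < n)%N -> q ^+ n != 1.

(* The multiple of z is used to make the sequences [xx] and [yy] both finitely supported. *)
Lemma exists_lam : exists lam, yy lam n.+3 = 0.
Proof.
pose e m := (-1) ^+ m : F.
have yE lam m : yy lam m.+1 = e m * (yy lam 1 - \sum_(i < m) e i * dx lam i).
  elim: m => [|m IH]; first by rewrite big_ord0 subr0 mul1r.
  rewrite yyS IH big_ord_recr /= {3}/e exprS -/(e m).
  have : e m * e m = 1 by rewrite -expr2 sqrr_sign.
  move: (\sum_(i < m) _) => S E.
  transitivity (dx lam m * (e m * e m) - e m * (yy lam 1 - S)); first by rewrite E mulr1.
  rewrite /=; ring.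
have sE lam : \sum_(i < n.+2) e i * dx lam i = \sum_(i < n.+2) e i * dx 0 i + q^-1 * lam.
  under eq_bigr do rewrite dx_lam mulrDr; rewrite big_split; congr (_ + _).
  rewrite big_ord_recl big1 /= => [|i _]; last by rewrite !mulr0.
  by rewrite /e; ring.
have q1 : 1 + q != 0 by have := one_add_neq0 q0 qn1 (isT : 0 < 1)%N.
(* This solves [xx lam 1 = \sum e i * dx lam i], where [lam] enters with coefficient -1 on the left
   and q^-1 on the right. *)
pose lam := (xx 0 1 - \sum_(i < n.+2) e i * dx 0 i) * q / (1 + q).
exists lam; rewrite yE (_ : yy lam 1 = xx lam 1) // (xx_lam lam) (sE lam) /lam.
apply/eqP; rewrite mulf_eq0; apply/orP; right; apply/eqP.
move: (xx 0 1) (\sum_(i < n.+2) _) => a b.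
by field; rewrite ?q0 ?q1.
Qed.

(* Both [resz] and [rese] vanish far out and satisfy a first order recurrence: the differences
   of consecutive terms only involve s and t locally. *)
Definition resz lam k :=
  (qk k)^-1 * (opB q 1 (fun k => xx lam k + xx lam k.+1) k
               - (q^+2)^-1 * opA q 1 (fun k => s k + s k.+1) k).

Lemma uuS k : uu k.+2 = (qk k.+2)^-1 * cc k.+2 - uu k.+1.
Proof.
apply: (mulfI (qk_neq0 k.+2)); rewrite mulrBr mulVKf ?qk_neq0 //.
have := uuE k.+2; rewrite /predseq mulr0 mul0r subr0 => <-; ring.
Qed.

Lemma reszS lam k : resz lam k.+1 = resz lam k.+2.
Proof.
rewrite /resz /opB /opA /= /opY /= !xxS /cx /= /coY /= !uuS /=.
have := qk_neq0 k; move: (qk k) => x x0; rewrite !mulr0 !addr0.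
move: (xx lam k.+1) => X1.
field.
by rewrite q0.
Qed.

Lemma resz0 lam k : resz lam k.+1 = 0.
Proof.
have -> : resz lam k.+1 = resz lam (k + n.+3).+1.
  elim: (n.+3) => [|j IH]; first by rewrite addn0.
  by rewrite IH reszS addnS.
(* Far out [xx] is 0 and s is constant, and A kills constants. *)
case: dS => _ [sn _] _ _ _.
rewrite /resz /opB /opA /= /opY /= !xx_large ?sn; try lia.
by ring.
Qed.

Definition rese lam m :=
  opBe (fun m => yy lam m.+2 - yy lam m.+1) m - opAe (fun m => t m.+2 - t m.+1) m.

Lemma reseS lam m : rese lam m = - q * rese lam m.+1.
Proof.
rewrite /rese /opBe /opAe /XA !yyS /dx /Xdd /predseq !wwS /dd /= !mulr0 !addr0.
have := qk_neq0 m; move: (qk m) => x x0.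
move: (yy lam m.+1) => X1.
field.
by rewrite q0 x0.
Qed.

Lemma rese0 lam m : yy lam n.+3 = 0 -> rese lam m = 0.
Proof.
move=> y0; have y0' k : yy lam (k + n.+3) = 0.
  by elim: k => [|k IH] //; rewrite addSn addnS yyS -addnS IH subr0 dx_large //; lia.
have -> : rese lam m = (- q) ^+ n.+3 * rese lam (n.+3 + m)%N.
  elim: (n.+3) => [|j IH]; first by rewrite mul1r.
  by rewrite IH reseS exprSr addSn; ring.
apply/eqP; rewrite mulf_eq0; apply/orP; right; apply/eqP.
(* Far out [yy] is 0 and t only alternates in sign; [opAe] kills such sequences. *)
case: dS => _ [_ tn] _ _ _.
have y1 k : yy lam (k + (n.+3 + m))%N = 0.
  by have := y0' (k + m)%N; congr (yy lam _ = 0); lia.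
have nM : (n.+1 < n.+3 + m)%N by lia.
move: (n.+3 + m)%N y1 nM => M y1 nM.
rewrite /rese /opBe /opAe /XA !(y1 1, y1 2, y1 3, y1 4) !tn; try lia.
have := qk_neq0 M; move: (t M) => T /=; move: (qk M) => x x0.
by field; rewrite q0 x0.
Qed.

Section Next.
Hypothesis two0 : 2%:R != 0 :> F.
Variables (fx : nat -> F).
Hypotheses (f0 : f 0 = 0) (f1 : f 1 = 0).
Hypothesis fx1 : fx 1 = - (1 + q) * f 2.
Hypothesis fxB : forall k, opB q 1 fx k = (q^+2)^-1 * opA q 1 f k.

(** Failure of the tail condition of [Sdata] for [xx] and [yy] with tail [fx]. *)
Definition defect lam m :=
  pe fx m - pe (fun k => xx lam k + xx lam k.+1) m + (yy lam m.+2 - yy lam m.+1).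

(** B turns the three terms of the defect into q^-2 A of the corresponding terms for s, t and f, by
    [fxB], [resz0] and [rese0]. These cancel by the tail condition, so B kills the defect. *)
Lemma defectSS lam m : yy lam n.+3 = 0 -> defect lam m.+2 = q * defect lam m.+1.
Proof.
move=> y0; case: dS => _ _ _ ft _.
have E1 : opBe (pe fx) m = opAe (pe f) m.
  by rewrite -pe_opA -pe_opB; apply: eq_pe => k _.
have E2 : opBe (pe (fun k => xx lam k + xx lam k.+1)) m =
    opAe (pe (fun k => s k + s k.+1)) m.
  rewrite -pe_opA -pe_opB; apply: eq_pe => -[|k] // _.
  have /eqP := resz0 lam k; rewrite mulf_eq0 invr_eq0 (negPf (qk_neq0 _)) /= subr_eq0.
  by move/eqP.
have E3 := rese0 m y0.
have : opBe (defect lam) m = 0.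
  transitivity (opBe (pe fx) m - opBe (pe (fun k => xx lam k + xx lam k.+1)) m
    + opBe (fun m => yy lam m.+2 - yy lam m.+1) m).
    by rewrite /defect /opBe /XA; ring.
  rewrite E1 E2; move/eqP: E3; rewrite subr_eq0 => /eqP ->.
  by rewrite /opAe /XA !ft; ring.
rewrite opBeE => e; apply/eqP; rewrite -subr_eq0; apply/eqP.
transitivity (qk m.+3 * ((qk m.+3)^-1 * defect lam m.+2 - (qk m.+2)^-1 * defect lam m.+1));
  last by rewrite e mulr0.
by rewrite /=; field; rewrite q0 qk_neq0.
Qed.

Lemma defect0 lam m : yy lam n.+3 = 0 -> defect lam m = 0.
Proof.
move=> y0; suff D01 : defect lam 0 = 0 /\ defect lam 1 = 0.
  case: D01 => D0 D1; case: m => // m; elim: m => // m IH.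
  by rewrite defectSS // IH mulr0.
(* The recurrence determines [fx 1] and [fx 2]; the two remaining values of the defect are
   combinations of the vanishing quantities [resz], [rese] and [G], found by elimination. *)
have Ez : resz lam 1 = 0 by apply: resz0.
have Ee : rese lam 0 = 0 by apply: rese0.
case: dS => -[st _] _ _ ft _.
pose G m := pe f m - (pe (fun k => s k + s k.+1) m - (t m.+2 - t m.+1)).
have G0 k : G k = 0 by rewrite /G ft subrr.
have fx2 : fx 2 = q^-1 * ((q^+2)^-1 * opA q 1 f 0 - fx 1).
  by rewrite -fxB /opB /= /opY /=; field.
have q1 : 1 + q != 0 by have := one_add_neq0 q0 qn1 (isT : 0 < 1)%N.
have uu0 : uu 0 = 0 by rewrite /uu /esum big1 // => i _; rewrite ep0 mulr0.
have uu1 : uu 1 = q^-1 * cc 1 - dd 0.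
  apply: (mulfI (qk_neq0 1)); have := uuE 1; rewrite /= uu0 addr0 => ->.
  by field.
have ww0 : ww 0 = cc 1 - q * dd 0 by rewrite /ww big_ord_recl big_ord0 /=; ring.
split.
- transitivity (- 2%:R^-1 * resz lam 1 + q^+3 / 2%:R * rese lam 0
    + (q^+3 + q^+2 - 1) / q^+2 * G 0 - (q + 1) / q^+2 * G 1); last first.
    by rewrite Ez Ee !G0; ring.
  rewrite /defect /resz /rese /G /opBe /opAe /XA /opB /opA /pe /= /opY /= ?f0 ?f1 ?fx1.
  rewrite -/(xx lam 1) !xxS /cx /= /coY /= !uuS uu1 uu0 /dx /Xdd /predseq !wwS ww0 /dd /= st.
  move: (xx lam 1) => X1.
  by field; rewrite ?q0 ?two0.
- transitivity (- q^+2 * (q^+2 + 3%:R / 2%:R * q + 1) / (q + 1)^+2 * resz lam 1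
    + q^+3 * (q^+3 / 2%:R - q - 1) / (q + 1)^+2 * rese lam 0
    + (2%:R * q^+5 + 3%:R * q^+4 + q^+2 + 2%:R * q + 1) / ((q + 1) * q^+2) * G 0
    + (q^+5 + q - 1) / q^+3 * G 1 - (q^+2 + 1) / q^+3 * G 2); last first.
    by rewrite Ez Ee !G0; ring.
  rewrite /defect /resz /rese /G /opBe /opAe /XA /opB /opA /pe /= /opY /= ?f0 ?f1 ?fx1 ?fx2.
  rewrite -/(xx lam 1) !xxS /cx /= /coY /= !uuS uu1 uu0 /dx /Xdd /predseq !wwS ww0 /dd /= st.
  rewrite /opA /= /opY /= ?f0 ?f1 ?fx1.
  move: (xx lam 1) => X1.
  by field; rewrite ?q0 ?two0 addrC ?q1.
Qed.
End Next.
End Core.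

Hypothesis qn1 : forall n, (0 < n)%N -> q ^+ n != 1.
Hypothesis two0 : 2%:R != 0 :> F.

(** The new data are [xx - s] and [yy - t]. By linearity their tail condition is [defect0], and far
    out only - s and - t survive, whence the constant - h. *)
Lemma Sdata_step n s t h f s' t' h' f' f'' :
    Sdata n s t h f -> Sdata n.+1 s' t' h' f' ->
    (forall k, (k <= n.+2)%N -> f'' k = 0) ->
    f 1 + f'' 1 = - (1 + q) * f' 2 ->
    (forall k, opB q 1 (fun k => f k + f'' k) k = (q^+2)^-1 * opA q 1 f' k) ->
  exists s'' t'', Sdata n.+2 s'' t'' (- h) f'' /\
    t'' n.+2 + t'' n.+3 = (q^-1 + (q ^+ n.+2)^-1) * (t' n.+1 + t' n.+2).
Proof.
move=> dS dS' f''0 fx1 fxB.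
have [lam y0] := exists_lam n s' t' qn1.
have y0' k : yy n s' t' lam (k + n.+3) = 0.
  by elim: k => [|k IH] //; rewrite addSn addnS yyS -addnS IH subr0 (dx_large dS') //; lia.
case: (dS) => -[st tn] [sn tn'] cd ft f0.
case: (dS') => _ _ _ _ f'0.
have dt m : (n <= m)%N -> t m.+1 + t m.+2 = 0 by move=> nm; rewrite (tn' m.+1) ?subrr.
exists (fun k => xx n s' t' lam k - s k), (fun m => yy n s' t' lam m - t m).
split; [split|].
- split; first by rewrite st.
  by rewrite (y0' 0) sub0r (tn' n.+2) ?(tn' n.+1) ?opprK ?tn.
- split=> [k nk|m nm]; first by rewrite (xx_large dS') // sub0r sn //; lia.
  have yE j : (n.+2 < j)%N -> yy n s' t' lam j = 0.
    by move=> nj; rewrite -(subnK nj) y0'.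
  by rewrite (yE m) // (yE m.+1) ?(leqW nm) // !sub0r tn' //; lia.
- case=> // k _; rewrite xxS.
  transitivity (cx n s' t' lam k.+1 - (s k.+2 - s k.+1)); first by ring.
  rewrite (cx_esum dS') // cd // -[X in _ - X]/(esum (fun m => t m.+1 + t m.+2) n k.+1).
  rewrite -(esum_widen (L := n.+2) k.+1 _ dt); last lia.
  rewrite /esum -sumrB; apply: eq_bigr => i _; rewrite yyS; ring.
- move=> m; have := defect0 dS' qn1 two0 (f'0 0 isT) (f'0 1 isT) fx1 fxB m y0.
  rewrite /defect peD ft => D; apply/eqP; rewrite -subr_eq0; apply/eqP; rewrite -[RHS]D.
  rewrite (_ : pe (fun k => xx _ _ _ _ k - _ + _) m =
    pe (fun k => xx n s' t' lam k + xx n s' t' lam k.+1) m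
    - pe (fun k => s k + s k.+1) m); last by rewrite -peB; apply: eq_pe => k _; ring.
  ring.
- exact: f''0.
transitivity (dx s' t' lam n.+1).
  transitivity (yy n s' t' lam n.+3 + yy n s' t' lam n.+2 - (t n.+2 + t n.+3)); first by ring.
  by rewrite yyS dt // subr0 subrK.
(* Only [dd n] survives in the top coefficient, through [Xdd] and the term q^-1 Y. *)
rewrite /dx /Xdd /= !(ww_large dS') // (dd_large dS' (m := n.+1)) //
  (dd_large dS' (m := n.+2)) //.
rewrite -qkE /= /dd; have := qk_neq0 n; move: (qk n) => x x0.
by field; rewrite q0 x0.
Qed.

End Step.

(** * The data s, t for every n *)

Section Family.
Variables (F : fieldType) (q : F).
Hypothesis q0 : q != 0.
Hypothesis qn1 : forall n, (0 < n)%N -> q ^+ n != 1.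
Hypothesis two0 : 2%:R != 0 :> F.

Definition ftail n k := tail q n (k + 8).

Lemma qshift_add8 k : qshift q (q ^- 8) (k + 8) = qshift q 1 k.
Proof. by rewrite qshiftE // qkE exprD mulfK ?expf_neq0. Qed.

Lemma act_add8 css u k :
  act q (q ^- 8) css u (k + 8) = act q 1 css (fun j => u (j + 8)%N) k.
Proof.
have XE (cs : seq F) j : opX cs u (j + 8) = opX cs (fun i => u (i + 8)%N) j.
  by elim: cs j => //= c cs IH j; rewrite -IH.
elim: css k => //= cs css IH k; rewrite XE /opY qshift_add8 IH.
by rewrite -(IH k.+1).
Qed.

Lemma ftail_rec n k :
  kp1 q (q ^+ n) * opB q 1 (ftail n) k - kp2 q (q ^+ n) * opB q 1 (ftail n.+2) k =
  kp0 q (q ^+ n) * opA q 1 (ftail n.+1) k.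
Proof.
have := tail_rec q0 qn1 n (k + 8).
rewrite /resT /opB /opA !act_add8 -/(opB q 1 _ k) -/(opB q 1 _ k) -/(opA q 1 _ k) => e.
by apply: subr0_eq; transitivity (- 0 : F); [rewrite -e; ring | rewrite oppr0].
Qed.

Lemma ftail_rec1 n :
  kp1 q (q ^+ n) * ftail n 1 - kp2 q (q ^+ n) * ftail n.+2 1 =
  - (1 + q) * (kp0 q (q ^+ n) * q^+2 * ftail n.+1 2).
Proof.
(* The padded index 7 is the exponent -1: there the recurrence links only the values at 1 and 2. *)
have := tail_rec q0 qn1 n 7.
have := @tail_vanish _ _ q0 qn1 n.+2; have := @tail_vanish _ _ q0 qn1 n.+1.
have := @tail_vanish _ _ q0 qn1 n.
rewrite /ftail !add1n !add2n.
move: (tail q n) (tail q n.+1) (tail q n.+2) => f g h f0 g0 h0.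
rewrite /resT /opB /opA /= /opY /=
  !(f0 7%N, f0 8%N, g0 7%N, g0 8%N, g0 9%N, h0 7%N, h0 8%N); try lia.
move=> e; apply: subr0_eq; transitivity (- 0 : F); last by rewrite oppr0.
rewrite -e; move: (kp1 _ _) (kp2 _ _) (kp0 _ _) => a b c.
by field.
Qed.

(** [hs] and [ds] are the constant h and the sum t_n + t_(n+1) of the data in [SdataP]. *)
Fixpoint hs n : F :=
  if n is n'.+1 then
    if n' is n''.+1 then kp1 q (q ^+ n'') / kp2 q (q ^+ n'') * hs n'' else scale1 q * (1 + q)
  else 1.

Fixpoint ds n : F :=
  if n is n'.+1 then
    if n' is n''.+1 then
      - (kp0 q (q ^+ n'') * q^+2 * (q^-1 + (q ^+ n)^-1)) / kp2 q (q ^+ n'') * ds n'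
    else 2%:R * scale1 q
  else 1.

Lemma pe_wseq m : pe q (fun k => wseq q k.-1) m = - (-1) ^+ m.
Proof.
elim: m => [|m IH]; first by rewrite /pe /=; field.
rewrite peS exprS mulN1r -IH -mulN1r -peZ; apply: eq_pe => -[|k] // _.
rewrite /opY /= qinvE // qkE; move: (wseq q k) => w.
by field; rewrite q0 expf_neq0.
Qed.

Lemma Sdata0 : Sdata q 0 (fun=> 1) (fun m => (-1) ^+ m.-1) 1 (ftail 0).
Proof.
split=> //.
- by split=> // -[|m] // _; rewrite exprS mulN1r.
- by move=> k _; rewrite subrr big_ord0.
- move=> m; rewrite (_ : pe q (ftail 0) m = pe q (fun k => 2%:R - 2%:R * wseq q k.-1) m).
    rewrite peB peZ pe_wseq exprS /= (_ : 1 + 1 = 2%:R) //; ring.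
  by apply: eq_pe => -[|k] // _; rewrite /ftail addnC.
- by case.
Qed.

Lemma pe_vseq m : pe q (fun k => vseq q k.-1) m = (m == 0)%:R.
Proof.
case: m => [|m]; first by rewrite /pe /=; field.
transitivity (pe q (fun=> 0 * 1) m); last by rewrite peZ mul0r.
by rewrite peS; apply: eq_pe => -[|k] // _; rewrite /opY /=; field.
Qed.

Lemma Sdata1 : exists s t,
  Sdata q 1 s t (hs 1) (ftail 1) /\ t 1 + t 2 = ds 1.
Proof.
pose s k : F := if (k <= 1)%N then 1 - q else 1 + q.
pose t m : F := if (m <= 1)%N then 1 - q else (1 + q) * (-1) ^+ m.
pose f k := if k is k'.+1 then 2%:R * (1 + q) * (1 + wseq q k')
   - 2%:R * q * (k' == 0)%:R + 2%:R * vseq q k' else 0.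
have d1 : t 1 + t 2 = 2%:R by rewrite /t /=; ring.
suff S1 : Sdata q 1 s t (1 + q) f.
  exists (fun k => scale1 q * s k), (fun k => scale1 q * t k); split.
    apply: (eq_Sdata (f := fun k => scale1 q * f k)); last exact: SdataZ.
    by case=> [|k]; rewrite /ftail addnC //= mulr0.
  by rewrite -mulrDr d1 mulrC.
split.
- by rewrite /s /t /= expr2; split => //; ring.
- by split=> [[|[|k]]|[|[|m]]] // _; rewrite /t /= !exprS; ring.
- case=> // k _; rewrite big_ord_recl big_ord0 /= d1 /s /ep /=.
  by case: k => [|k] /=; ring.
- move=> m; transitivity (pe q (fun k => s k + s k.+1) m
      + 2%:R * (1 + q) * pe q (fun k => wseq q k.-1) m + 2%:R * pe q (fun k => vseq q k.-1) m).
    rewrite -!peZ -!peD; apply: eq_pe => -[|[|k]] // _; rewrite /f /s /=; ring.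
  rewrite pe_wseq pe_vseq -addrA; congr (_ + _).
  by case: m => [|m]; rewrite /t /= ?exprS; ring.
- by case=> [|[|k]] // _; rewrite /f /=; field.
Qed.

Lemma kp0_neq0 n : kp0 q (q ^+ n) != 0.
Proof. by rewrite /kp0 -!exprM -exprD mulf_neq0 ?expf_neq0 ?sub_neq0. Qed.

(** Scaling the data by [kp1] and [kp0 * q^2] puts the three-term recurrence into the form asked by
    [Sdata_step]; division by [- kp2] then gives the tail [ftail n.+2]. *)
Lemma SdataP n :
  (exists s t, Sdata q n s t (hs n) (ftail n) /\ ((0 < n)%N -> t n + t n.+1 = ds n)) /\
  (exists s t, Sdata q n.+1 s t (hs n.+1) (ftail n.+1) /\ t n.+1 + t n.+2 = ds n.+1).
Proof.
elim: n => [|n [[s [t [S0 _]]] [s' [t' [S1 d1]]]]].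
  split; last exact: Sdata1.
  by exists (fun=> 1), (fun m => (-1) ^+ m.-1); split => //; apply: Sdata0.
split; first by exists s', t'.
have := ftail_rec n; have := ftail_rec1 n; have := kp2_neq0 q0 qn1 n.
rewrite [hs _]/= [ds _.+2]/= -/(ds n.+1).
move: (kp0 q _) (kp1 q _) (kp2 q _) => a b c c0 T1 T.
have X0 : forall k, (k <= n.+2)%N -> - c * ftail n.+2 k = 0.
  by move=> k kn; rewrite /ftail tail_vanish ?mulr0 //; lia.
case: (Sdata_step q0 qn1 two0 (SdataZ b S0) (SdataZ (a * q ^+ 2) S1) X0).
- by rewrite mulNr T1 mulrA.
- move=> k; transitivity (b * opB q 1 (ftail n) k - c * opB q 1 (ftail n.+2) k).
    by rewrite /opB /= /opY /=; ring.
  by rewrite T /opA /= /opY /=; field.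
move=> s2 [t2 [S2 d2]].
exists (fun k => - c^-1 * s2 k), (fun k => - c^-1 * t2 k); split.
  rewrite (_ : b / c * hs n = - c^-1 * - (b * hs n)); last by ring.
  apply: (eq_Sdata (f := fun k => - c^-1 * (- c * ftail n.+2 k))); last exact: SdataZ.
  by move=> k; field.
rewrite -mulrDr d2 -mulrDr d1; ring.
Qed.

End Family.

(** * The product *)

Section Product.
Variables (F : fieldType) (q : F).
Hypothesis qn1 : forall n, (0 < n)%N -> q ^+ n != 1.

Notation omq n := (1 - q ^+ n).

(** The factors with k = n of the triple product, telescoped over j. *)
Definition gf_ratio n := \prod_(i < n) (omq (2 * n + i) / omq (n + 2 * i)).

Lemma prod3_recr n :
  \prod_(1 <= i < n.+2) \prod_(i <= j < n.+2) \prod_(j <= k < n.+2)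
      (omq (i + j + k - 1) / omq (i + j + k - 2)) =
  (\prod_(1 <= i < n.+1) \prod_(i <= j < n.+1) \prod_(j <= k < n.+1)
      (omq (i + j + k - 1) / omq (i + j + k - 2))) * gf_ratio n.+1.
Proof.
pose f i j k := omq (i + j + k - 1) / omq (i + j + k - 2).
rewrite -/(f _ _ _).
transitivity (\prod_(1 <= i < n.+2) ((\prod_(i <= j < n.+1) \prod_(j <= k < n.+1) f i j k) *
   (omq (2 * n.+1 + i.-1) / omq (n.+1 + 2 * i.-1)))).
  apply: eq_big_nat => i /andP[i1 i2].
  transitivity (\prod_(i <= j < n.+2) ((\prod_(j <= k < n.+1) f i j k) * f i j n.+1)).
    by apply: eq_big_nat => j /andP[_ j2]; rewrite big_nat_recr.
  rewrite big_split /= big_nat_recr //= (big_geq (leqnn _)) mulr1; congr (_ * _).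
  transitivity (\prod_(i <= j < n.+2) (omq (i + j.+1 + n.+1 - 2) / omq (i + j + n.+1 - 2))).
    apply: eq_big_nat => j _; rewrite /f; congr (omq _ / _); lia.
  rewrite (telescope_prodf (f := fun j => omq (i + j + n.+1 - 2))) //.
    by congr (omq _ / omq _); lia.
  by move=> k /andP[ik _]; rewrite subr_eq0 eq_sym qn1 //; lia.
rewrite big_split /= big_nat_recr //= (big_geq (leqnn n.+1)) mulr1; congr (_ * _).
by rewrite /gf_ratio big_add1 big_mkord.
Qed.

Lemma gf_ratio_prod n : \prod_(1 <= i < n.+1) \prod_(i <= j < n.+1) \prod_(j <= k < n.+1)
      (omq (i + j + k - 1) / omq (i + j + k - 2)) = \prod_(m < n) gf_ratio m.+1.
Proof.
elim: n => [|n IH]; first by rewrite big_geq // big_ord0.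
by rewrite prod3_recr IH big_ord_recr.
Qed.

(** The numerators are compared by splitting a product of n + 6 factors after 4 or after n of them,
    the denominators by splitting n + 3 factors after 1 or after n. *)
Lemma gf_ratioSS n : (0 < n)%N ->
  gf_ratio n.+2 * (omq (2 * n) * omq (2 * n + 1) * omq (2 * n + 2) * omq (2 * n + 3)) =
  gf_ratio n * (omq n * omq (3 * n + 1) * omq (3 * n + 3) * omq (3 * n + 5)).
Proof.
move=> n0; have nz k : (0 < k)%N -> omq k != 0 by move=> k0; rewrite subr_eq0 eq_sym qn1.
rewrite /gf_ratio !prodf_div.
pose num n := \prod_(i < n) omq (2 * n + i).
pose den n := \prod_(i < n) omq (n + 2 * i).
rewrite -/(num n) -/(num n.+2) -/(den n) -/(den n.+2).
have dn0 k : (0 < k)%N -> den k != 0.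
  by move=> k0; apply/prodf_neq0 => i _; apply: nz; lia.
have P3 (g : nat -> F) : \prod_(i < 3) g i = g 0 * g 1 * g 2%N.
  by rewrite !big_ord_recr big_ord0 /= mul1r.
have P4 (g : nat -> F) : \prod_(i < 4) g i = g 0 * g 1 * g 2%N * g 3%N.
  by rewrite big_ord_recr /= P3.
have P6 (g : nat -> F) : \prod_(i < 6) g i = g 0 * g 1 * g 2%N * g 3%N * g 4%N * g 5%N.
  by rewrite !big_ord_recr big_ord0 /= mul1r.
have numE : (omq (2 * n) * omq (2 * n + 1) * omq (2 * n + 2) * omq (2 * n + 3)) * num n.+2 =
    num n * (omq (3 * n) * omq (3 * n + 1) * omq (3 * n + 2) * omq (3 * n + 3)
             * omq (3 * n + 4) * omq (3 * n + 5)).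
  transitivity (\prod_(i < n + 6) omq (2 * n + i)).
    rewrite (_ : n + 6 = 4 + n.+2)%N ?big_split_ord /=; last lia.
    rewrite (P4 (fun i => omq (2 * n + i))) addn0; congr (_ * _).
    by apply: eq_bigr => i _; congr (1 - q ^+ _); lia.
  rewrite big_split_ord /= -/(num n) (P6 (fun i => omq (2 * n + (n + i)))).
  by do 6?congr (_ * _); congr (1 - q ^+ _); lia.
have denE : omq n * den n.+2 = den n * (omq (3 * n) * omq (3 * n + 2) * omq (3 * n + 4)).
  transitivity (\prod_(i < n + 3) omq (n + 2 * i)).
    rewrite (_ : n + 3 = 1 + n.+2)%N ?big_split_ord /=; last lia.
    rewrite big_ord1 muln0 addn0; congr (_ * _).
    by apply: eq_bigr => i _; congr (1 - q ^+ _); lia.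
  rewrite big_split_ord /= -/(den n) (P3 (fun i => omq (n + 2 * (n + i)))).
  by do 3?congr (_ * _); congr (1 - q ^+ _); lia.
have n00 : omq n != 0 by apply: nz.
have n30 : omq (3 * n) * omq (3 * n + 2) * omq (3 * n + 4) != 0.
  by rewrite !mulf_neq0 ?nz; lia.
have -> : den n.+2 = den n * (omq (3 * n) * omq (3 * n + 2) * omq (3 * n + 4)) / omq n.
  by rewrite -denE mulrAC mulfV // mul1r.
have D0 := dn0 n n0.
transitivity ((omq (2 * n) * omq (2 * n + 1) * omq (2 * n + 2) * omq (2 * n + 3)) * num n.+2
  * (omq n / (den n * (omq (3 * n) * omq (3 * n + 2) * omq (3 * n + 4))))).
  by rewrite invf_div; ring.
rewrite numE.
move: (omq (3 * n)) (omq (3 * n + 2)) (omq (3 * n + 4)) (omq n) n00 n30 (den n) D0.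
move=> a b c d d0; rewrite !mulf_eq0 !negb_or => /andP[/andP[a0 b0] c0] e e0.
by field; rewrite a0 b0 c0 e0.
Qed.

Lemma gf_ratio1 : gf_ratio 1 = 1 + q.
Proof.
have := qn1 (isT : 0 < 1)%N; rewrite eq_sym -subr_eq0 => q1.
by rewrite /gf_ratio big_ord1 /=; field.
Qed.

Lemma gf_ratio2 : gf_ratio 2 = (1 - q ^+ 5) / (1 - q ^+ 2).
Proof.
have := qn1 (isT : 0 < 2)%N; rewrite eq_sym -subr_eq0 => q2.
have := qn1 (isT : 0 < 4)%N; rewrite eq_sym -subr_eq0 => q4.
by rewrite /gf_ratio !big_ord_recl big_ord0 /= mulr1 /bump /=; field; rewrite q2 q4.
Qed.
End Product.

(** * Matching the data with the product *)

Section Ratio.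
Variables (F : fieldType) (q : F).
Hypothesis q0 : q != 0.
Hypothesis qn1 : forall n, (0 < n)%N -> q ^+ n != 1.
Hypothesis two0 : 2%:R != 0 :> F.

Lemma ds_neq0 n : ds q n.+1 != 0.
Proof.
elim: n => [|n IH].
  by rewrite /= /scale1 !mulf_neq0 ?invr_eq0 ?oppr_eq0 ?sub_neq0 // -[q]expr1 sub_neq0.
rewrite [ds _ _]/= -/(ds q n.+1) mulf_neq0 // mulf_neq0 ?invr_eq0 ?kp2_neq0 // oppr_eq0.
apply: mulf_neq0; first exact: mulf_neq0 (kp0_neq0 q0 qn1 n) (expf_neq0 2 q0).
have -> : q^-1 + (q ^+ n.+2)^-1 = (1 + q ^+ n.+1) / q ^+ n.+2.
  rewrite mulrDl mul1r addrC; congr (_ + _); rewrite (exprS q n.+1).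
  by field; rewrite q0 expf_neq0.
by rewrite mulf_neq0 ?invr_eq0 ?expf_neq0 ?one_add_neq0.
Qed.

(** Both sides satisfy the same two-step recurrence, by [gf_ratioSS] on the right; n = 1 and n = 2
    are computed. *)
Lemma hs_ds n : 2%:R * hs q n.+1 = gf_ratio q n.+1 * ds q n.+1.
Proof.
suff [] : 2%:R * hs q n.+1 = gf_ratio q n.+1 * ds q n.+1 /\
  2%:R * hs q n.+2 = gf_ratio q n.+2 * ds q n.+2 by [].
have q1 : 1 - q != 0 by rewrite -[q]expr1 sub_neq0.
have q2 := sub_neq0 qn1 (isT : 0 < 2)%N.
elim: n => [|n [IH1 IH2]].
  split; first by rewrite gf_ratio1 //=; ring.
  have q5 := sub_neq0 qn1 (isT : 0 < 5)%N.
  have q8 := sub_neq0 qn1 (isT : 0 < 8)%N.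
  rewrite gf_ratio2 //= /kp1 /kp2 /kp0 /scale1 !expr0 !expr1n !mulr1.
  by field; rewrite q5 q8 q0 q2.
split=> //.
have nz k : (0 < k)%N -> 1 - q ^+ k != 0 by apply: sub_neq0.
have E : (1 - q ^+ 2 * (q ^+ n.+1) ^+ 2) * (1 - q ^+ 3 * (q ^+ n.+1) ^+ 2) != 0.
  by rewrite -!exprM -!exprD mulf_neq0 ?nz.
have hE : hs q n.+3 = kp1 q (q ^+ n.+1) / kp2 q (q ^+ n.+1) * hs q n.+1 by [].
have dE m : ds q m.+2 = - (kp0 q (q ^+ m) * q ^+ 2 * (q^-1 + (q ^+ m.+2)^-1))
   / kp2 q (q ^+ m) * ds q m.+1 by [].
rewrite hE mulrCA IH1 !dE.
have := gf_ratioSS qn1 (ltn0Sn n).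
set x := q ^+ n; have x0 : x != 0 by apply: expf_neq0.
have e2 : q ^+ (2 * n.+1) = q ^+ 2 * x ^+ 2.
  by rewrite /x -exprM -exprD; congr (q ^+ _); lia.
have e3 : q ^+ (3 * n.+1) = q ^+ 3 * x ^+ 3.
  by rewrite /x -exprM -exprD; congr (q ^+ _); lia.
rewrite !exprD e2 e3 expr1 !(exprS q n) -/x.
have n1 := nz n.+1 isT; have n2 := nz (2 * n.+1)%N isT; have n3 := nz (2 * n.+1 + 1)%N isT.
have n4 := nz (2 * n.+1 + 2)%N isT; have n5 := nz (2 * n.+1 + 3)%N isT.
have k2 := kp2_neq0 q0 qn1 n; have k2' := kp2_neq0 q0 qn1 n.+1.
move: n1 n2 n3 n4 n5 k2 k2'.
rewrite !exprD e2 expr1 !(exprS q n) -/x /kp2 => n1 n2 n3 n4 n5 k2 k2' R.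
have -> : q ^+ n.+2 = q ^+ 2 * x by rewrite /x -exprD.
have -> : q ^+ n.+3 = q ^+ 3 * x by rewrite /x -exprD.
have P0 := mulf_neq0 (mulf_neq0 (mulf_neq0 n2 n3) n4) n5.
have -> : gf_ratio q n.+3 = gf_ratio q n.+1 *
    ((1 - q * x) * (1 - q ^+ 3 * x ^+ 3 * q) * (1 - q ^+ 3 * x ^+ 3 * q ^+ 3) *
     (1 - q ^+ 3 * x ^+ 3 * q ^+ 5)) /
    ((1 - q ^+ 2 * x ^+ 2) * (1 - q ^+ 2 * x ^+ 2 * q) *
     (1 - q ^+ 2 * x ^+ 2 * q ^+ 2) * (1 - q ^+ 2 * x ^+ 2 * q ^+ 3)).
  by rewrite -R mulfK.
have k8 : 1 - q ^+ 8 * x ^+ 3 != 0 by move: k2; rewrite mulf_eq0 => /norP[].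
have k8' : 1 - q ^+ 8 * (q * x) ^+ 3 != 0 by move: k2'; rewrite mulf_eq0 => /norP[].
rewrite /kp1 /kp0; move: (gf_ratio q n.+1) (ds q n.+1) => r d.
by field; move: k8'; rewrite !exprMn x0 q0 k8 n2 n3 n4 n5 => ->.
Qed.
End Ratio.

(** * Clifford relations *)

Section Fock.
Variables (F : fieldType) (q : F).

Implicit Types (w : seq bool -> F) (v phi : nat -> F).

Notation cf w := (fun l => w (false :: l)).
Notation ct w := (fun l => w (true :: l)).
Notation sh v := (fun k : nat => v k.+1).

(* A list of size n is an occupation vector of the sites 1, ..., n, and [w] is an element
   of the exterior algebra on the basis z, ..., z^n. *)
Fixpoint wedge v w l : F :=
  match l with
  | [::] => 0
  | true :: l' => v 1 * w (false :: l') - wedge (sh v) (ct w) l'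
  | false :: l' => wedge (sh v) (cf w) l'
  end.

Fixpoint contr phi w l : F :=
  match l with
  | [::] => 0
  | false :: l' => phi 1 * w (true :: l') + contr (sh phi) (cf w) l'
  | true :: l' => - contr (sh phi) (ct w) l'
  end.

Definition parity w l := (-1) ^+ count id l * w l.

Definition lin a w b w' : seq bool -> F := fun l => a * w l + b * w' l.

(* [Lam false] is the exterior power of [1 + X] and [Lam true] is [z /\ Lam false]. *)
Fixpoint Lam c w l : F :=
  match l with
  | [::] => if c then 0 else w [::]
  | false :: l' => if c then 0 else Lam false (cf w) l' + Lam true (ct w) l'
  | true :: l' =>
      if c then Lam false (cf w) l' + Lam true (ct w) l' else Lam false (ct w) l'
  end.

(** The list starts at site k + 1, and an occupied site j weighs q^j. *)
Fixpoint wgt k l : F :=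
  if l is b :: l' then (if b then q ^+ k.+1 else 1) * wgt k.+1 l' else 1.

Fixpoint total n w : F :=
  if n is n'.+1 then total n' (cf w) + total n' (ct w) else w [::].

Lemma wedge_lin v a w b w' l :
  wedge v (lin a w b w') l = a * wedge v w l + b * wedge v w' l.
Proof.
elim: l v w w' => [|[] l IH] v w w' /=; first by ring.
  by rewrite (IH (sh v) (ct w) (ct w')) /lin; ring.
by rewrite (IH (sh v) (cf w) (cf w')).
Qed.

Lemma wedge_linl a u b v w l :
  wedge (fun k => a * u k + b * v k) w l = a * wedge u w l + b * wedge v w l.
Proof.
elim: l u v w => [|[] l IH] u v w /=; first by ring.
  by rewrite (IH (sh u) (sh v) (ct w)); ring.
by rewrite (IH (sh u) (sh v) (cf w)).
Qed.

Lemma contr_lin v a w b w' l :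
  contr v (lin a w b w') l = a * contr v w l + b * contr v w' l.
Proof.
elim: l v w w' => [|[] l IH] v w w' /=; first by ring.
  by rewrite (IH (sh v) (ct w) (ct w')); ring.
by rewrite (IH (sh v) (cf w) (cf w')) /lin; ring.
Qed.

Lemma Lam_lin c a w b w' l :
  Lam c (lin a w b w') l = a * Lam c w l + b * Lam c w' l.
Proof.
elim: l c w w' => [|[] l IH] [] w w' /=; rewrite /lin; try ring.
- by rewrite (IH false (cf w) (cf w')) (IH true (ct w) (ct w')); ring.
- by rewrite (IH false (ct w) (ct w')).
- by rewrite (IH false (cf w) (cf w')) (IH true (ct w) (ct w')); ring.
Qed.

Lemma total_lin n a w b w' :
  total n (lin a w b w') = a * total n w + b * total n w'.
Proof.
elim: n w w' => [|n IH] w w' //=.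
by rewrite (IH (cf w) (cf w')) (IH (ct w) (ct w')); ring.
Qed.

Lemma eq_wedge u v w l : (forall k, (0 < k)%N -> u k = v k) -> wedge u w l = wedge v w l.
Proof.
elim: l u v w => [|[] l IH] u v w uv //=; last by apply: IH => k _; apply: uv.
by rewrite uv // (IH (sh u) (sh v)) // => k _; apply: uv.
Qed.

Lemma ct_wedge v w : ct (wedge v w) = lin (v 1) (cf w) (-1) (wedge (sh v) (ct w)).
Proof. by apply: functional_extensionality => l; rewrite /lin /=; ring. Qed.

Lemma cf_contr v w : cf (contr v w) = lin (v 1) (ct w) 1 (contr (sh v) (cf w)).
Proof. by apply: functional_extensionality => l; rewrite /lin /=; ring. Qed.

Lemma ct_contr v w : ct (contr v w) = lin 0 w (-1) (contr (sh v) (ct w)).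
Proof. by apply: functional_extensionality => l; rewrite /lin /=; ring. Qed.

Lemma cf_Lam w : cf (Lam false w) = lin 1 (Lam false (cf w)) 1 (Lam true (ct w)).
Proof. by apply: functional_extensionality => l; rewrite /lin /=; ring. Qed.

Lemma wedge0 v l : wedge v (fun=> 0) l = 0.
Proof. by elim: l v => [|[] l IH] v //=; rewrite ?IH ?mulr0 ?subr0. Qed.

Lemma contr0 v l : contr v (fun=> 0) l = 0.
Proof. by elim: l v => [|[] l IH] v //=; rewrite ?IH ?mulr0 ?oppr0 ?addr0. Qed.

(** Functoriality of the exterior power. The entry [v 0] is kept because removing the first site
    turns [v 1] into it; there it multiplies z. *)
Lemma Lam_wedge v w l :
  Lam false (wedge v w) l + v 0 * Lam true w l =
    wedge (fun k => v k + v k.-1) (Lam false w) l /\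
  Lam true (wedge v w) l = - wedge (fun k => v k + v k.-1) (Lam true w) l.
Proof.
elim: l v w => [|b l IH] v w; first by rewrite /=; split; ring.
have E w' : wedge (sh (fun k => v k + v k.-1)) w' l = wedge (fun k => v k.+1 + v k.-1.+1) w' l.
  by apply: eq_wedge; case.
have [A0 A1] := IH (sh v) (cf w); have [B0 B1] := IH (sh v) (ct w).
have L0 : Lam false (cf (wedge v w)) l + Lam true (ct (wedge v w)) l =
  wedge (sh (fun k => v k + v k.-1)) (cf (Lam false w)) l.
  rewrite ct_wedge cf_Lam Lam_lin wedge_lin !E -A0 B1 /=; ring.
case: b => /=; split.
- by have /= -> := ct_wedge v w; rewrite Lam_lin E -B0 /=; ring.
- by rewrite [LHS]L0 /=; ring.
- by rewrite mulr0 addr0 [LHS]L0.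
- by rewrite (wedge0 (sh (fun k => v k + v k.-1))) oppr0.
Qed.

(** Contraction pulls [phi] back along 1 + X. Since [phi] vanishes beyond the last site, cutting off
    z^(n+1) does no harm. *)
Lemma contr_Lam phi w l : (forall k, (size l < k)%N -> phi k = 0) ->
  contr phi (Lam false w) l = Lam false (contr (fun k => phi k + phi k.+1) w) l /\
  contr phi (Lam true w) l =
    phi 1 * Lam false w l - Lam true (contr (fun k => phi k + phi k.+1) w) l.
Proof.
elim: l phi w => [|b l IH] phi w phi0; first by rewrite /= phi0 //; split; ring.
have phi0' k : (size l < k)%N -> phi k.+1 = 0 by move=> lk; apply: phi0.
clear phi0.
have [A0 A1] := IH (sh phi) (cf w) phi0'; have [B0 B1] := IH (sh phi) (ct w) phi0'.
have L0 : Lam false (cf (contr (fun k => phi k + phi k.+1) w)) l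
    + Lam true (ct (contr (fun k => phi k + phi k.+1) w)) l =
    phi 1 * Lam false (ct w) l + contr (sh phi) (cf (Lam false w)) l.
  rewrite cf_contr ct_contr cf_Lam !Lam_lin contr_lin A0 B1; ring.
case: b => /=; split.
- by have /= -> := ct_contr (fun k => phi k + phi k.+1) w; rewrite Lam_lin -B0; ring.
- by rewrite [X in _ - X]L0 /=; ring.
- by rewrite [RHS]L0.
- by rewrite contr0; ring.
Qed.

Lemma wgt_wedge k v w l :
  wgt k l * wedge v w l =
  wedge (fun j => q ^+ (k + j) * v j) (fun l => wgt k l * w l) l.
Proof.
elim: l k v w => [|[] l IH] k v w; rewrite /= ?mulr0 //.
  rewrite (_ : (fun l => q ^+ k.+1 * wgt k.+1 l * w (true :: l)) =
    lin (q ^+ k.+1) (fun l => wgt k.+1 l * ct w l) 0 w); last first.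
    by apply: functional_extensionality => l'; rewrite /lin; ring.
  rewrite wedge_lin (eq_wedge (u := fun j => q ^+ (k + j.+1) * v j.+1)
    (v := fun j => q ^+ (k.+1 + j) * v j.+1)) => [|j _]; last first.
    by rewrite addnS.
  by rewrite -IH addn1; ring.
rewrite (_ : (fun l => 1 * wgt k.+1 l * w (false :: l)) = fun l => wgt k.+1 l * cf w l); last first.
  by apply: functional_extensionality => l'; rewrite mul1r.
rewrite mul1r IH; apply: eq_wedge => j _; by rewrite addnS.
Qed.

Lemma eq_contr u v w l : (forall k, (0 < k)%N -> u k = v k) -> contr u w l = contr v w l.
Proof.
elim: l u v w => [|[] l IH] u v w uv //=.
  by rewrite (IH (sh u) (sh v)) // => k _; apply: uv.
by rewrite uv // (IH (sh u) (sh v)) // => k _; apply: uv.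
Qed.

Lemma wgt_contr k v w l :
  wgt k l * contr (fun j => q ^+ (k + j) * v j) w l =
  contr v (fun l => wgt k l * w l) l.
Proof.
elim: l k v w => [|[] l IH] k v w; rewrite /= ?mulr0 //.
  rewrite (_ : (fun l => q ^+ k.+1 * wgt k.+1 l * w (true :: l)) =
    lin (q ^+ k.+1) (fun l => wgt k.+1 l * ct w l) 0 w); last first.
    by apply: functional_extensionality => l'; rewrite /lin; ring.
  rewrite contr_lin (eq_contr (u := fun j => q ^+ (k + j.+1) * v j.+1)
    (v := fun j => q ^+ (k.+1 + j) * v j.+1)) => [|j _]; last first.
    by rewrite addnS.
  by rewrite -IH; ring.
rewrite (_ : (fun l => 1 * wgt k.+1 l * w (false :: l)) = fun l => wgt k.+1 l * cf w l); last first.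
  by apply: functional_extensionality => l'; rewrite mul1r.
rewrite -IH addn1 (eq_contr (u := fun j => q ^+ (k + j.+1) * v j.+1)
    (v := fun j => q ^+ (k.+1 + j) * v j.+1)) => [|j _]; last first.
  by rewrite addnS.
ring.
Qed.

(** Exterior power of z^k -> q^k z^k + q^(k+1) z^(k+1), the map [coY]. *)
Definition step w l := wgt 0 l * Lam false w l.

Lemma step_wedge v w l : v 0 = 0 -> step (wedge v w) l = wedge (coY q v) (step w) l.
Proof.
move=> v0; have [E _] := Lam_wedge v w l; rewrite v0 mul0r addr0 in E.
rewrite /step E wgt_wedge; apply: eq_wedge => -[|k] // _.
by rewrite /coY qkE add0n.
Qed.

Lemma step_contr phi w l : (forall k, (size l < k)%N -> phi k = 0) ->
  contr phi (step w) l = step (contr (opY q 1 phi) w) l.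
Proof.
move=> phi0; rewrite /step -(wgt_contr 0).
have phi0' k : (size l < k)%N -> q ^+ (0 + k) * phi k = 0.
  by move=> lk; rewrite phi0 ?mulr0.
have [-> _] := contr_Lam w phi0'; congr (_ * Lam _ _ _).
apply: functional_extensionality => l'; apply: eq_contr => k _.
by rewrite /opY qkE !add0n exprS; ring.
Qed.

Lemma eq_Lam c w w' l : (forall l', size l' = size l -> w l' = w' l') -> Lam c w l = Lam c w' l.
Proof.
elim: l c w w' => [|b l IH] c w w' ww /=; first by rewrite ww.
have IHb b' c' : Lam c' (fun l => w (b' :: l)) l = Lam c' (fun l => w' (b' :: l)) l.
  by apply: IH => l' sl; apply: ww; rewrite /= sl.
by rewrite !IHb.
Qed.

Lemma eq_step w w' l : (forall l', size l' = size l -> w l' = w' l') -> step w l = step w' l.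
Proof. by move=> ww; rewrite /step (eq_Lam _ ww). Qed.

Lemma step_lin a w b w' l : step (lin a w b w') l = a * step w l + b * step w' l.
Proof. by rewrite /step Lam_lin; ring. Qed.

Lemma Lam_parity w l : Lam false (parity w) l = parity (Lam false w) l /\
  Lam true (parity w) l = - parity (Lam true w) l.
Proof.
have cfP w' : cf (parity w') = parity (cf w') by [].
have ctP w' : ct (parity w') = lin (-1) (parity (ct w')) 0 w'.
  by apply: functional_extensionality => l'; rewrite /lin /parity /= exprS; ring.
elim: l w => [|b l IH] w; first by rewrite /parity /= !mul1r oppr0.
have [A0 A1] := IH (cf w); have [B0 B1] := IH (ct w).
have L0 : Lam false (cf (parity w)) l + Lam true (ct (parity w)) l =
  (-1) ^+ count id l * (Lam false (cf w) l + Lam true (ct w) l).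
  by rewrite ctP cfP Lam_lin A0 B1 /parity; ring.
case: b => /=; split.
- by rewrite -/(ct (parity w)) ctP Lam_lin B0 /parity /= exprS; ring.
- by rewrite [LHS]L0 /parity /= exprS; ring.
- by rewrite [LHS]L0.
- by rewrite /parity mulr0 oppr0.
Qed.

Lemma step_parity w l : step (parity w) l = parity (step w) l.
Proof. by rewrite /step; have [-> _] := Lam_parity w l; rewrite /parity; ring. Qed.

(** Left multiplication by e_1 = q z. *)
Definition addone w l := if l is true :: l' then q * w (false :: l') else 0.

Lemma addone_lin a w b w' l : addone (lin a w b w') l = a * addone w l + b * addone w' l.
Proof. by case: l => [|[] l]; rewrite /lin /=; ring. Qed.

Lemma wedge_zero v w l : (forall k, (0 < k)%N -> v k = 0) -> wedge v w l = 0.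
Proof.
elim: l v w => [|[] l IH] v w v0 //=.
  by rewrite v0 // mul0r IH ?subr0 // => k _; apply: v0.
by rewrite IH // => k _; apply: v0.
Qed.

Lemma wedge_ep0 w l : wedge (ep q 0) w l = addone w l.
Proof.
case: l => [|[] l] //=; rewrite wedge_zero /ep /= ?mulr1 ?subr0 // => -[|k] // _ /=;
  by rewrite ?mulr0.
Qed.

Lemma wedge_addone v w l : wedge v (addone w) l = - addone (wedge v w) l.
Proof.
case: l => [|[] l] /=; rewrite ?wedge0 ?oppr0 //.
rewrite (_ : (fun l0 => q * w (false :: l0)) = lin q (cf w) 0 w) ?wedge_lin; first ring.
by apply: functional_extensionality => l'; rewrite /lin; ring.
Qed.

Lemma contr_addone phi w l : (forall k, (size l < k)%N -> phi k = 0) ->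
  contr phi (addone w) l = q * phi 1 * w l - addone (contr phi w) l.
Proof.
case: l => [|[] l] phi0 /=; first by rewrite phi0 //; ring.
  rewrite (_ : (fun l0 => q * w (false :: l0)) = lin q (cf w) 0 w) ?contr_lin; first ring.
  by apply: functional_extensionality => l'; rewrite /lin; ring.
by rewrite contr0; ring.
Qed.

Lemma parity_addone w l : parity (addone w) l = - addone (parity w) l.
Proof. by case: l => [|[] l]; rewrite /parity /= ?exprS; ring. Qed.

(** As [step] takes e_m to e_(m+1), W_(m+1) is (1 + e_1) /\ [step] W_m. *)
Fixpoint Wn m l : F :=
  if m is m'.+1 then step (Wn m') l + addone (step (Wn m')) l else (~~ has id l)%:R.

Lemma WnS m : Wn m.+1 = lin 1 (step (Wn m)) 1 (addone (step (Wn m))).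
Proof. by apply: functional_extensionality => l; rewrite /lin /= !mul1r. Qed.

Lemma Wn0_contr phi l : contr phi (Wn 0) l = 0.
Proof.
elim: l phi => [|[] l IH] phi //=; last by rewrite mulr0 add0r IH.
by rewrite contr0 oppr0.
Qed.

Lemma esum_recl a m k :
  esum q a m.+1 k = a 0 * ep q 0 k + coY q (esum q (fun i => a i.+1) m) k.
Proof. by rewrite esumY /esum !big_ord_recl mul0r add0r; congr (_ + _). Qed.

Lemma esum_at0 a m : esum q a m 0 = 0.
Proof. by rewrite /esum big1 // => i _; rewrite ep0 mulr0. Qed.

(** Induction by peeling off 1 + e_1: [step] transports the relation for the shifted t, and e_1
    anticommutes with wedge and contraction up to phi(e_1) = t_2 - t_1. *)
Lemma Wn_annihilator m t phi l :
    (forall k, (size l < k)%N -> phi k = 0) ->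
    (forall i, (i < m)%N -> pe q phi i = t i.+2 - t i.+1) ->
  wedge (esum q (fun i => t i.+1 + t i.+2) m) (Wn m) l - contr phi (Wn m) l =
  t 1 * Wn m l - t m.+1 * parity (Wn m) l.
Proof.
elim: m t phi l => [|m IH] t phi l phi0 pet.
  rewrite Wn0_contr wedge_zero => [|k _]; last by rewrite /esum big_ord0.
  rewrite subrr /parity /= -mulrBr -{1}[_%:R]mul1r -mulrBl.
  have [_|/=] := boolP (has id l); first by rewrite !mulr0.
  by rewrite has_count -eqn0Ngt => /eqP ->; rewrite subrr mul0r mulr0.
set w := step (Wn m).
have IHm l' : size l' = size l ->
    wedge (esum q (fun i => t i.+2 + t i.+3) m) (Wn m) l' - contr (opY q 1 phi) (Wn m) l' =
    t 2 * Wn m l' - t m.+2 * parity (Wn m) l'.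
  move=> sl; apply: (IH (sh t)) => [k lk|i im].
    have lk' : (size l < k)%N by rewrite -sl.
    by rewrite /opY (phi0 _ lk') (phi0 _ (leqW lk')) !(mulr0, addr0).
  by rewrite -peS pet.
have K l' : size l' = size l ->
    wedge (esum q (fun i => t i.+1 + t i.+2) m.+1) w l' - contr phi w l' =
    (t 1 + t 2) * addone w l' + t 2 * w l' - t m.+2 * parity w l'.
  move=> sl.
  rewrite (eq_wedge (v := fun k => (t 1 + t 2) * ep q 0 k +
    1 * coY q (esum q (fun i => t i.+2 + t i.+3) m) k)); last first.
    by move=> k _; rewrite esum_recl mul1r.
  rewrite wedge_linl wedge_ep0 /w -step_wedge ?esum_at0 //.
  rewrite step_contr ?sl // -step_parity.
  have := @eq_step (lin 1 (wedge (esum q (fun i => t i.+2 + t i.+3) m) (Wn m)) (-1)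
    (contr (opY q 1 phi) (Wn m))) (lin (t 2) (Wn m) (- t m.+2) (parity (Wn m))) l'.
  rewrite !step_lin => E; rewrite -addrA mul1r -[in RHS]addrA; congr (_ + _).
  transitivity (t 2 * step (Wn m) l' + - t m.+2 * step (parity (Wn m)) l'); last by rewrite mulNr.
  rewrite -E => [|l'' sl'']; first by ring.
  by rewrite /lin mul1r mulN1r mulNr; apply: IHm; rewrite sl''.
set p := esum q _ m.+1; rewrite -/p in K.
have A : addone (wedge p w) l - addone (contr phi w) l =
    t 2 * addone w l - t m.+2 * addone (parity w) l.
  transitivity (addone (lin 1 (wedge p w) (-1) (contr phi w)) l).
    by rewrite addone_lin; ring.
  transitivity (addone (lin 1 (lin (t 1 + t 2) (addone w) (t 2) w) (- t m.+2) (parity w)) l).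
    case: l {phi0 IHm} K => [|[] l] K //=; congr (_ * _).
    by rewrite /lin mul1r mulN1r K // mul1r mulNr.
  rewrite !addone_lin; case: l {phi0 IHm K} => [|[] l] /=; ring.
have peq : q * phi 1 = t 2 - t 1 by rewrite -pet.
have Kl := K l erefl.
rewrite WnS -/w !wedge_lin contr_lin wedge_addone contr_addone // peq.
transitivity ((wedge p w l - contr phi w l) - (t 2 - t 1) * w l
  - (addone (wedge p w) l - addone (contr phi w) l)); first by ring.
rewrite A Kl.
have -> : parity (lin 1 w 1 (addone w)) l = parity w l + parity (addone w) l.
  by rewrite /parity /lin; ring.
by rewrite parity_addone /lin; ring.
Qed.

(** The dual family, for the linear form [total]: removing the first site shifts s, and the boundary
    terms telescope. *)
Lemma total_parity n s : forall w,
  total n (fun l => contr (fun k => s k + s k.+1) w l - wedge (fun k => s k.+1 - s k) w l) =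
  s 1 * total n w - s n.+1 * total n (parity w).
Proof.
elim: n s => [|n IH] s w.
  by rewrite /= /parity /= mul1r; ring.
rewrite /=.
have -> : (fun l => (s 1 + s 2) * w (true :: l) + contr (fun k => s k.+1 + s k.+2) (cf w) l
    - wedge (fun k => s k.+2 - s k.+1) (cf w) l) =
  lin (s 1 + s 2) (ct w) 1 (fun l => contr (fun k => s k.+1 + s k.+2) (cf w) l
    - wedge (fun k => s k.+2 - s k.+1) (cf w) l).
  by apply: functional_extensionality => l; rewrite /lin; ring.
have -> : (fun l => - contr (fun k => s k.+1 + s k.+2) (ct w) l
    - ((s 2 - s 1) * w (false :: l) - wedge (fun k => s k.+2 - s k.+1) (ct w) l)) =
  lin (s 1 - s 2) (cf w) (-1) (fun l => contr (fun k => s k.+1 + s k.+2) (ct w) l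
    - wedge (fun k => s k.+2 - s k.+1) (ct w) l).
  by apply: functional_extensionality => l; rewrite /lin; ring.
rewrite !total_lin (IH (sh s) (cf w)) (IH (sh s) (ct w)).
have -> : (fun l => parity w (true :: l)) = lin (-1) (parity (ct w)) 0 w.
  by apply: functional_extensionality => l; rewrite /lin /parity /= exprS; ring.
rewrite total_lin /parity /=; ring.
Qed.

Lemma Lam0 c w l : (forall l', size l' = size l -> w l' = 0) -> Lam c w l = 0.
Proof.
move=> w0; rewrite (eq_Lam _ (w' := lin 0 w 0 w)) => [|l' sl]; last by rewrite w0 // /lin; ring.
by rewrite Lam_lin; ring.
Qed.

Lemma parity_Wn0 l : parity (Wn 0) l = Wn 0 l.
Proof.
rewrite /parity /=; have [_|] := boolP (has id l); first by rewrite mulr0.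
by rewrite has_count -eqn0Ngt => /eqP ->; rewrite mul1r.
Qed.

Lemma step_Wn0 l : step (Wn 0) l = Wn 0 l.
Proof.
rewrite /step; suff H k : wgt k l * Lam false (Wn 0) l = Wn 0 l by [].
elim: l k => [|[] l IH] k; first by rewrite mul1r.
  by rewrite [Lam _ _ _]/= Lam0 ?mulr0.
by rewrite /= mul1r [X in _ + X]Lam0 // addr0 IH.
Qed.

(** The last factor 1 + e_(n+1) is moved to the front; passing e_(n+1) across W_n costs the parity
    sign. *)
Lemma Wn_top n l : Wn n.+1 l = Wn n l + wedge (ep q n) (parity (Wn n)) l.
Proof.
elim: n l => [|n IH] l.
  rewrite [LHS]/= step_Wn0 wedge_ep0; congr (_ + _); case: l => [|[] l] //.
  by rewrite /addone parity_Wn0 step_Wn0.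
have stepE l' : step (Wn n.+1) l' =
    step (Wn n) l' + wedge (ep q n.+1) (parity (step (Wn n))) l'.
  transitivity (step (lin 1 (Wn n) 1 (wedge (ep q n) (parity (Wn n)))) l').
    by apply: eq_step => l'' _; rewrite IH /lin !mul1r.
  rewrite step_lin !mul1r step_wedge ?ep0 //; congr (_ + _).
  by congr wedge; apply: functional_extensionality => l''; rewrite step_parity.
rewrite [LHS]/= stepE (_ : addone _ l = addone (step (Wn n)) l
    + addone (wedge (ep q n.+1) (parity (step (Wn n)))) l); last first.
  by case: l => [|[] l]; rewrite /addone ?addr0 // stepE mulrDr.
rewrite WnS /lin.
have -> : parity (lin 1 (step (Wn n)) 1 (addone (step (Wn n)))) =
    lin 1 (parity (step (Wn n))) (-1) (addone (parity (step (Wn n)))).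
  apply: functional_extensionality => l'; rewrite /lin mulN1r -parity_addone /parity; ring.
by rewrite wedge_lin wedge_addone; ring.
Qed.

Lemma Lam_supp0 w l : (forall l', size l' = size l -> has id l' -> w l' = 0) ->
  has id l -> Lam false w l = 0.
Proof.
elim: l w => [|[] l IH] w w0 //= hl; first by rewrite Lam0 // => l' sl; rewrite w0 //= sl.
rewrite IH //; last by move=> l' sl hl'; rewrite w0 //= sl.
by rewrite Lam0 ?addr0 // => l' sl; rewrite w0 //= sl.
Qed.

Lemma Lam_supp m c w l :
  (forall l', size l' = size l -> has id (drop m l') -> w l' = 0) ->
  has id (drop m.+1 l) -> Lam c w l = 0.
Proof.
elim: l m c w => [|b l IH] m c w w0 //= hl.
have z b' c' : (m != 0)%N -> Lam c' (fun l0 => w (b' :: l0)) l = 0.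
  case: m w0 hl => // m w0 hl _; apply: (IH m) => // l' sl hl'.
  by apply: w0; rewrite //= sl.
have [m0|m0] := eqVneq m 0%N; last by rewrite !z //; case: (b); case: (c); rewrite ?addr0.
rewrite {}m0 drop0 in w0 hl.
have z1 c' : Lam c' (ct w) l = 0 by apply: Lam0 => l' sl; apply: w0; rewrite /= ?sl.
have z0 : Lam false (cf w) l = 0.
  by apply: Lam_supp0 => // l' sl hl'; apply: w0; rewrite /= ?sl ?drop0.
by rewrite !z1 z0; case: (b); case: (c); rewrite ?addr0.
Qed.

Lemma Wn_supp m l : has id (drop m l) -> Wn m l = 0.
Proof.
elim: m l => [|m IH] l hl; first by rewrite /= -[l]drop0 hl.
have s0 l' : has id (drop m.+1 l') -> step (Wn m) l' = 0.
  by move=> hl'; rewrite /step (Lam_supp _ _ hl') ?mulr0 // => l'' _; apply: IH.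
rewrite /= s0 // add0r; case: l hl => [|[] l] //= hl.
by rewrite s0 ?mulr0.
Qed.

Lemma wgt_rcons k l : wgt k (rcons l false) = wgt k l.
Proof. by elim: l k => [|b l IH] k /=; rewrite ?mulr1 // IH. Qed.

Lemma Lam_rcons c w l : (forall l', size l' = size l -> w (rcons l' true) = 0) ->
  Lam c w (rcons l false) = Lam c (fun l' => w (rcons l' false)) l.
Proof.
elim: l c w => [|b l IH] c w w0 /=; first by rewrite addr0.
have E b' c' : Lam c' (fun l0 => w (b' :: l0)) (rcons l false) =
    Lam c' (fun l0 => w (b' :: rcons l0 false)) l.
  by apply: IH => l' sl; apply: (w0 (b' :: l')); rewrite /= sl.
by rewrite !E.
Qed.

Lemma Wn_rcons m l : (m <= size l)%N -> Wn m (rcons l false) = Wn m l.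
Proof.
elim: m l => [|m IH] l ml; first by rewrite /= has_rcons.
have s0 l' : (m <= size l')%N -> step (Wn m) (rcons l' false) = step (Wn m) l'.
  move=> ml'; rewrite /step wgt_rcons Lam_rcons => [|l'' sl]; last first.
    by rewrite Wn_supp // drop_rcons ?sl // has_rcons.
  by congr (_ * _); apply: eq_Lam => l'' sl; rewrite IH ?sl.
rewrite /= s0 ?(ltnW ml) //; congr (_ + _).
case: l ml => [|[] l] //= ml; congr (_ * _).
exact: (s0 (false :: l) (ltnW ml)).
Qed.

Lemma total_rcons n w : total n.+1 w =
  total n (fun l => w (rcons l false)) + total n (fun l => w (rcons l true)).
Proof.
elim: n w => [|n IH] w //.
transitivity (total n.+1 (cf w) + total n.+1 (ct w)); first by [].
by rewrite (IH (cf w)) (IH (ct w)) /=; ring.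
Qed.

Lemma eq_total n w w' : (forall l, size l = n -> w l = w' l) -> total n w = total n w'.
Proof.
elim: n w w' => [|n IH] w w' ww /=; first exact: ww.
by congr (_ + _); apply: IH => l sl; apply: ww; rewrite /= sl.
Qed.

Lemma total_Wn_widen n : total n.+1 (Wn n) = total n (Wn n).
Proof.
rewrite total_rcons (eq_total (w' := Wn n)) => [|l sl]; last by rewrite Wn_rcons ?sl.
rewrite [X in _ + X](eq_total (w' := lin 0 (Wn n) 0 (Wn n))) => [|l sl].
  by rewrite total_lin; ring.
by rewrite Wn_supp /lin ?mul0r ?addr0 // drop_rcons ?sl // has_rcons.
Qed.

Lemma parity_wedge v w l : wedge v (parity w) l = - parity (wedge v w) l.
Proof.
elim: l v w => [|[] l IH] v w; rewrite /parity /= ?mulr0 ?oppr0 //.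
  rewrite (_ : (fun l0 => _) = lin (-1) (parity (ct w)) 0 w) ?wedge_lin ?IH.
    by rewrite /parity exprS; ring.
  by apply: functional_extensionality => l'; rewrite /lin /parity exprS; ring.
by rewrite (IH (sh v) (cf w)).
Qed.

Lemma parity_contr v w l : contr v (parity w) l = - parity (contr v w) l.
Proof.
elim: l v w => [|[] l IH] v w; rewrite /parity /= ?mulr0 ?oppr0 //.
  rewrite (_ : (fun l0 => _) = lin (-1) (parity (ct w)) 0 w) ?contr_lin ?IH.
    by rewrite /parity exprS; ring.
  by apply: functional_extensionality => l'; rewrite /lin /parity exprS; ring.
by rewrite (IH (sh v) (cf w)) /parity add0n add1n exprS; ring.
Qed.

Lemma eq_contr_size u v w l :
  (forall k, (0 < k <= size l)%N -> u k = v k) -> contr u w l = contr v w l.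
Proof.
elim: l u v w => [|[] l IH] u v w uv //=.
  by rewrite (IH (sh u) (sh v)) // => k /andP[_ kl]; apply: uv.
by rewrite uv // (IH (sh u) (sh v)) // => k /andP[_ kl]; apply: uv.
Qed.

(** Evaluate [total_parity] at [parity (Wn n)]. The terms up to e_n are removed by [Wn_annihilator],
    and the remaining multiple of e_(n+1) yields W_(n+1) by [Wn_top]. *)
Lemma total_ratio n s t h f : Sdata q n.+1 s t h f ->
  (t n.+1 + t n.+2) * total n.+1 (Wn n.+1) = 2%:R * h * total n (Wn n).
Proof.
case=> -[st tn] [sn _] cd ft f0.
set d := t n.+1 + t n.+2.
(* The cut meets the support hypothesis of [Wn_annihilator]; contraction on n + 1 sites and the
   values at e_1, ..., e_n do not see it. *)
pose phi k := if (k <= n.+1)%N then s k + s k.+1 else 0.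
have pet i : (i < n)%N -> pe q phi i = t i.+2 - t i.+1.
  move=> i_n; have := ft i.
  rewrite (_ : pe q f i = pe q (fun=> 0 * 0) i); last first.
    by apply: eq_pe => k /andP[_ ki]; rewrite f0 ?mulr0 //; lia.
  rewrite peZ mul0r => /eqP; rewrite eq_sym subr_eq0 => /eqP <-.
  by apply: eq_pe => k /andP[_ ki]; rewrite /phi ifT //; lia.
pose X := wedge (ep q n) (parity (Wn n)).
have E l : size l = n.+1 ->
    contr (fun k => s k + s k.+1) (parity (Wn n)) l
      - wedge (fun k => s k.+1 - s k) (parity (Wn n)) l =
    lin 1 (lin (t 1) (parity (Wn n)) (- t n.+1) (Wn n)) (- d) X l.
  move=> sl.
  have := @Wn_annihilator n t phi l.
  rewrite (eq_contr_size (u := fun k => s k + s k.+1) (v := phi)); last first.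
    by move=> k /andP[_ kl]; rewrite /phi -sl kl.
  rewrite (eq_wedge (u := fun k => s k.+1 - s k) (v := fun k =>
     1 * esum q (fun i => t i.+1 + t i.+2) n k + d * ep q n k)); last first.
    by move=> k k0; rewrite cd // mul1r [LHS]big_ord_recr.
  rewrite wedge_linl -/X parity_contr parity_wedge /lin => A.
  have {}A := A _ pet.
  have p2 : (-1) ^+ count id l * parity (Wn n) l = Wn n l.
    by rewrite /parity mulrA -expr2 sqrr_sign mul1r.
  transitivity ((-1) ^+ count id l * (wedge (esum q (fun i => t i.+1 + t i.+2) n) (Wn n) l
      - contr phi (Wn n) l) - d * X l); first by rewrite /parity; ring.
  rewrite A => [|k]; last by rewrite /phi sl ltnNge => /negPf ->.
  by rewrite mulrBr [X in _ - X - _]mulrCA p2 /parity; ring.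
have := total_parity n.+1 s (parity (Wn n)).
rewrite (eq_total E) !total_lin.
have -> : parity (parity (Wn n)) = Wn n.
  by apply: functional_extensionality => l; rewrite /parity mulrA -expr2 sqrr_sign mul1r.
rewrite (sn n.+2) // st total_Wn_widen => T.
rewrite (eq_total (w' := lin 1 (Wn n) 1 X)) => [|l _]; last by rewrite Wn_top /lin !mul1r.
rewrite total_lin total_Wn_widen.
have dX : d * total n.+1 X = (h - t n.+1) * total n (Wn n).
  apply: subr0_eq; move/eqP: T; rewrite -subr_eq0 => /eqP T.
  transitivity (- 0 : F); [rewrite -T; ring | exact: oppr0].
by rewrite !mul1r mulrDr dX /d tn; ring.
Qed.

End Fock.

(** * The generating function *)

Section TotalWn.
Variables (F : fieldType) (q : F).
Hypothesis q0 : q != 0.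
Hypothesis qn1 : forall n, (0 < n)%N -> q ^+ n != 1.
Hypothesis two0 : 2%:R != 0 :> F.

Lemma total_Wn n : total n (Wn q n) = \prod_(m < n) gf_ratio q m.+1.
Proof.
elim: n => [|n IH]; first by rewrite big_ord0.
have [_ [s [t [S d]]]] := SdataP q0 qn1 two0 n.
have := total_ratio S; rewrite d hs_ds // mulrAC [LHS]mulrC => /(mulIf (ds_neq0 q0 qn1 two0 n)).
by rewrite IH big_ord_recr /= mulrC.
Qed.
End TotalWn.

(** * Coordinates of W_n as sums over chains *)

Section ChainSum.
Variables (F : fieldType) (q : F).

Lemma total_allbits n w : total n w = \sum_(l <- allbits n) w l :> F.
Proof.
elim: n w => [|n IH] w /=; first by rewrite big_seq1.
by rewrite big_cat !big_map !IH.
Qed.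

(** Moves by at most one site never exchange particles, so the minors of 1 + X are 0 or 1 and no
    signs occur. *)
Lemma Lam_compat c w l :
  Lam c w l = \sum_(l' <- allbits (size l)) (compat c l' l)%:R * w l' :> F.
Proof.
elim: l c w => [|b l IH] c w /=.
  by rewrite big_seq1 /=; case: c; rewrite ?mul0r ?mul1r.
rewrite big_cat !big_map /=.
have z (G : seq bool -> F) : \sum_(i <- allbits (size l)) false%:R * G i = 0.
  by rewrite big1 // => i _; rewrite mul0r.
by case: b; case: c; rewrite /= ?IH ?z ?add0r ?addr0.
Qed.

(** The factor 1 + e_1 adds the case [c = true]. The particle counts make the two cases exclusive,
    so their sum is the indicator of [rstep]. *)
Lemma Wn_step m l : Wn q m.+1 l =
  wgt q 0 l * \sum_(l' <- allbits (size l)) (rstep l l')%:R * Wn q m l'.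
Proof.
transitivity (wgt q 0 l * (Lam false (Wn q m) l + Lam true (Wn q m) l)).
  rewrite /= /step; case: l => [|[] l] /=; rewrite ?expr1; ring.
rewrite !Lam_compat -big_split; congr (_ * _).
apply: eq_bigr => l' _ /=; rewrite -mulrDl; congr (_ * _); rewrite /rstep.
case: (boolP (compat false l' l)) => [/compatP[_ e0 _]|]; last by rewrite add0r.
by case: (boolP (compat true l' l)) => [/compatP[_ e1 _]|]; [lia|rewrite addr0].
Qed.

Lemma Wn_chains m l : Wn q m l =
  \sum_(c <- seqs m (allbits (size l)))
    (path rstep l c && ~~ has id (last l c))%:R * \prod_(x <- l :: c) wgt q 0 x.
Proof.
elim: m l => [|m IH] l.
  have wgt1 k : ~~ has id l -> wgt q k l = 1.
    by elim: l k => [|[] l IH] k //= hl; rewrite mul1r IH.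
  rewrite big_seq1 big_seq1 /=.
  by have [_|h] := boolP (has id l); rewrite ?mul0r ?wgt1 ?mulr1.
rewrite Wn_step [in RHS]/= big_allpairs_dep mulr_sumr; apply: eq_big_seq => l'.
rewrite mem_allbits => /eqP sl'; rewrite IH sl' mulrA mulr_sumr; apply: eq_bigr => c _.
rewrite [in RHS]big_cons /= -andbA; case: (rstep l l'); rewrite /= ?mulr0 ?mul0r //.
by rewrite mulr1 mulrCA.
Qed.

Lemma total_Wn_chains n : total n (Wn q n) =
  \sum_(L <- seqs n.+1 (allbits n) | valid_chain L) \prod_(x <- L) wgt q 0 x.
Proof.
rewrite [RHS]big_mkcond /= total_allbits [seqs _ _]/= big_allpairs_dep; apply: eq_big_seq => l.
rewrite mem_allbits Wn_chains => /eqP ->; apply: eq_bigr => c _.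
by rewrite /valid_chain /=; case: ifP; rewrite ?mul1r ?mul0r.
Qed.
End ChainSum.

(** * Weights of chains and orbit counts *)

Section Weights.
Variables (F : fieldType) (q : F).

(** A particle at position j of the list is counted in exactly j of the tails [drop i l], whose
    counts are the heights. *)
Lemma wgtE k l : wgt q k l =
  q ^+ (k * count id l + \sum_(i < size l) count id (drop i l))%N.
Proof.
elim: l k => [|b l IH] k; first by rewrite big_ord0 muln0.
rewrite [wgt _ _ _]/= big_ord_recl IH drop0 [count id (b :: l)]/=.
rewrite (eq_bigr (fun i : 'I_(size l) => count id (drop i l))) => [|i _]; last by [].
by case: b; rewrite ?mul1r -?exprD; congr (_ ^+ _); lia.
Qed.

Lemma prod_wgt_chain n' (f : parray n'.+1) : f \in TSPP n'.+1 ->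
  \prod_(x <- chain f) wgt q 0 x = q ^+ #|orbits3 f|.
Proof.
move=> fT; rewrite card_orbits3 //.
rewrite big_map -[iota 0 n'.+2]/(index_iota 0 n'.+2) big_mkord -prodrXr.
apply: eq_bigr => m _; rewrite wgtE mul0n add0n size_bitrow; congr (_ ^+ _).
by apply: eq_bigr => k _; rewrite count_bitrow.
Qed.

Lemma sum_TSPP n : (0 < n)%N -> \sum_(f in TSPP n) q ^+ #|orbits3 f| = total n (Wn q n).
Proof.
case: n => // n' _; rewrite total_Wn_chains -[RHS]big_filter.
rewrite -(perm_big _ (_ : perm_eq [seq chain f | f <- enum (TSPP n'.+1)] _)).
  rewrite big_map big_enum /=; apply: eq_bigr => f fT; by rewrite prod_wgt_chain.
apply: uniq_perm.
- rewrite map_inj_in_uniq ?enum_uniq // => f g; rewrite !mem_enum; exact: chain_inj.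
- by rewrite filter_uniq // seqs_uniq // allbits_uniq.
move=> L; rewrite mem_filter; apply/mapP/andP => [[f + ->]|[vL sL]].
  by rewrite mem_enum => fT; rewrite chain_valid // chain_seqs.
by have [f fT <-] := chain_surj sL vL; exists f; rewrite ?mem_enum.
Qed.

End Weights.

Lemma qvar_neq0 : qvar != 0.
Proof. by rewrite tofrac_eq0 polyX_eq0. Qed.

Lemma qvarX_neq1 n : (0 < n)%N -> qvar ^+ n != 1.
Proof.
move=> n0; rewrite -tofracXn -tofrac1 tofrac_eq; apply/eqP.
move=> /(congr1 (fun p : {poly rat} => size p)).
by rewrite size_polyXn size_poly1; case: n n0.
Qed.

Lemma two_neq0 : 2%:R != 0 :> RatFun.
Proof. by rewrite -tofrac1 -tofracMn tofrac_eq0 -polyC_natr polyC_eq0. Qed.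

Theorem theorem1 (n : nat) (hn : (0 < n)%N) :
  \sum_(f in TSPP n) qvar ^+ #|orbits3 f|
  = \prod_(1 <= i < n.+1) \prod_(i <= j < n.+1) \prod_(j <= k < n.+1)
      ((1 - qvar ^+ (i + j + k - 1)) / (1 - qvar ^+ (i + j + k - 2))).
Proof.
rewrite sum_TSPP // (total_Wn qvar_neq0 qvarX_neq1 two_neq0).
by rewrite (gf_ratio_prod qvarX_neq1).
Qed.
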